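(* Let $P\subset\mathbb R^n$ be an $n$-dimensional strongly monotypic polytope, and let $X_1,\dots,X_k$ be a skeleton of its set of normals $X=N(P)$. Then for some sufficiently small $\epsilon>0$, $P$ can be covered by at most $|X_1|\cdot|X_2|\cdots|X_k|$ translates of $(1-\epsilon)P$. In particular, since $|X_1|\cdots|X_k|\le 2^n$, $P$ can be covered by at most $2^n$ translates of $(1-\epsilon)P$.
   Context: $N(P)$ is the set of outer unit normals of the facets of $P$. $\mathcal A(P)$ is the arrangement of hyperplanes containing the facets of $P$; $P$ is strongly monotypic if every polytope $Q$ with $N(Q)=N(P)$ has $\mathcal A(Q)$ combinatorially equivalent to $\mathcal A(P)$. A skeleton of a finite set $X\subset\mathbb R^n\setminus\{0\}$ is a collection of pairwise disjoint subsets $X_1,\dots,X_k\subseteq X$ such that each $X_i$ is the vertex set of a simplex whose relative interior contains $0$, and $\mathbb R^n=\operatorname{span}X_1\oplus\cdots\oplus\operatorname{span}X_k$. *)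

(* Defs.v *)
From HB Require Import structures.
From mathcomp Require Import all_boot all_order all_algebra.
From mathcomp Require Import reals.
Set Implicit Arguments. Unset Strict Implicit. Unset Printing Implicit Defensive.
Import Order.TTheory GRing.Theory Num.Theory.
Local Open Scope ring_scope.

Section Defs.
Variables (R : realType) (n : nat).
Local Notation vec := 'rV[R]_n.

Definition dot (u v : vec) : R := \sum_(i < n) u ord0 i * v ord0 i.

Definition in_conv (V : seq vec) (x : vec) : Prop :=
  exists c : 'I_(size V) -> R,
    (forall i, 0 <= c i) /\ \sum_i c i = 1 /\ x = \sum_i c i *: V`_i.

Definition is_polytope (P : vec -> Prop) : Prop :=
  exists V : seq vec, V != [::] /\ forall x, P x <-> in_conv V x.

Definition full_dim (P : vec -> Prop) : Prop :=
  exists (x0 : vec) (M : 'M[R]_n),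
    P x0 /\ (forall i, P (x0 + row i M)) /\ row_free M.

(* u is an outer unit normal of a facet of P: |u| = 1 and the face
   {x in P | <u,x> = max_P <u,.>} has dimension n-1 (contains n
   affinely independent points). *)
Definition facet_normal (P : vec -> Prop) (u : vec) : Prop :=
  dot u u = 1 /\
  exists (x0 : vec) (M : 'M[R]_(n.-1, n)),
    P x0 /\ (forall z, P z -> dot u z <= dot u x0) /\
    (forall i, P (x0 + row i M) /\ dot u (x0 + row i M) = dot u x0) /\
    row_free M.

(* Sign vectors (covectors) of the faces of the arrangement A(P) of the
   facet hyperplanes {x | <u,x> = h_P(u)}, u in N(P); the hyperplanes are
   indexed by their normals u, and s u = 0 for u outside N(P). *)
Definition arr_covector (P : vec -> Prop) (s : vec -> R) : Prop :=
  exists x : vec, forall u : vec,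
    (facet_normal P u ->
       exists y, P y /\ (forall z, P z -> dot u z <= dot u y) /\
                 s u = Num.sg (dot u x - dot u y)) /\
    (~ facet_normal P u -> s u = 0).

(* Face order of an arrangement in terms of sign vectors. *)
Definition cov_le (s t : vec -> R) : Prop := forall u, s u = 0 \/ s u = t u.

Definition arr_comb_equiv (P Q : vec -> Prop) : Prop :=
  exists phi : (vec -> R) -> (vec -> R),
    (forall s, arr_covector P s -> arr_covector Q (phi s)) /\
    (forall t, arr_covector Q t -> exists s, arr_covector P s /\ phi s = t) /\
    (forall s s', arr_covector P s -> arr_covector P s' ->
       (cov_le s s' <-> cov_le (phi s) (phi s'))).

Definition strongly_monotypic (P : vec -> Prop) : Prop :=
  is_polytope P /\ full_dim P /\
  forall Q : vec -> Prop, is_polytope Q -> full_dim Q ->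
    (forall u, facet_normal Q u <-> facet_normal P u) ->
    arr_comb_equiv P Q.

Definition aff_indep (s : seq vec) : Prop :=
  forall l : 'I_(size s) -> R, \sum_i l i = 0 -> \sum_i l i *: s`_i = 0 ->
    forall i, l i = 0.

Definition zero_in_relint (s : seq vec) : Prop :=
  exists l : 'I_(size s) -> R,
    (forall i, 0 < l i) /\ \sum_i l i = 1 /\ \sum_i l i *: s`_i = 0.

Definition in_span (s : seq vec) (v : vec) : Prop :=
  exists c : 'I_(size s) -> R, v = \sum_i c i *: s`_i.

Definition direct_sum_full (k : nat) (Xs : 'I_k -> seq vec) : Prop :=
  (forall v : vec, exists w : 'I_k -> vec,
      (forall i, in_span (Xs i) (w i)) /\ v = \sum_i w i) /\
  (forall w : 'I_k -> vec, (forall i, in_span (Xs i) (w i)) ->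
      \sum_i w i = 0 -> forall i, w i = 0).

Definition skeleton (X : vec -> Prop) (k : nat) (Xs : 'I_k -> seq vec) : Prop :=
  (forall x, X x -> x != 0) /\
  (forall i, uniq (Xs i)) /\
  (forall i x, x \in Xs i -> X x) /\
  (forall i j, i != j -> forall x, x \in Xs i -> x \notin Xs j) /\
  (forall i, aff_indep (Xs i) /\ zero_in_relint (Xs i)) /\
  direct_sum_full Xs.

End Defs.

(* Main.v *)
Require Import Defs.
From HB Require Import structures.
From mathcomp Require Import all_boot all_order all_algebra.
From mathcomp Require Import boolp reals.
From mathcomp Require Import ring lra.
Set Implicit Arguments. Unset Strict Implicit. Unset Printing Implicit Defensive.
Import Order.TTheory GRing.Theory Num.Theory.
Local Open Scope ring_scope.

(** Among the polytopes with the given normals, offsets in general position give an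
    arrangement in which at most [3 ^ n] faces contain any given face; if [n] hyperplanes
    with independent normals and one further hyperplane met in a point, more than [3 ^ n]
    faces would contain it.  Hence strong monotypicity forbids such concurrences for all
    offsets, and moving the offsets along a segment shows that all these polytopes have
    the same vertex cones.  One of them is a small perturbation of the product of simplices
    circumscribed along the skeleton, so every vertex cone of [P] lies in a cone of that
    product, that is, in the cone generated by the skeleton with one normal of each [X_i]
    left out.  Translating [(1 - eps) P] towards the corresponding vertex of the
    product of simplices covers a neighbourhood of the vertex of [P], and there are
    [|X_1| ... |X_k|] such vertices. *)

(** * Conditions valid for all sufficiently small positive parameters *)

Section Small.
Variable R : realType.

(** A filter at [0] from the right: finitely many such conditions hold at once for a common
    parameter, so each perturbation below only needs its conditions treated one by one. *)
Definition small (Q : R -> Prop) : Prop :=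
  exists e, 0 < e /\ forall t, 0 < t < e -> Q t.

Lemma small_wit Q : small Q -> exists t, 0 < t /\ Q t.
Proof.
case=> e [e0 He]; exists (e / 2); split; first by rewrite divr_gt0.
by apply: He; lra.
Qed.

Lemma smallW (Q Q' : R -> Prop) :
  (forall t, 0 < t -> Q t -> Q' t) -> small Q -> small Q'.
Proof.
move=> QQ' [e [e0 He]]; exists e; split=> // t /[dup] /andP[t0 _] /He; exact: QQ'.
Qed.

Lemma small_true (Q : R -> Prop) : (forall t, Q t) -> small Q.
Proof. by move=> HQ; exists 1; split. Qed.

Lemma small_and (Q Q' : R -> Prop) :
  small Q -> small Q' -> small (fun t => Q t /\ Q' t).
Proof.
case=> e [e0 He] [e' [e'0 He']]; exists (Num.min e e'); split.
  by rewrite lt_min e0 e'0.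
by move=> t /andP[t0]; rewrite lt_min => /andP[te te']; split;
  [apply: He|apply: He']; rewrite t0.
Qed.

Lemma small_all (T : eqType) (s : seq T) (Q : T -> R -> Prop) :
  (forall x, x \in s -> small (Q x)) ->
  small (fun t => forall x, x \in s -> Q x t).
Proof.
elim: s => [|a s IHs] Hs; first exact: small_true.
have Hsa : small (Q a) by apply: Hs; rewrite mem_head.
have /IHs Hss : forall x, x \in s -> small (Q x).
  by move=> x xs; apply: Hs; rewrite inE xs orbT.
apply: smallW (small_and Hsa Hss) => t _ [Ha Hb] x.
by rewrite inE => /predU1P[->|/Hb].
Qed.

Lemma small_forall (T : finType) (Q : T -> R -> Prop) :
  (forall x, small (Q x)) -> small (fun t => forall x, Q x t).
Proof.
move=> HQ; apply: smallW (small_all (s := enum T) (fun x _ => HQ x)) => t _ Ht x.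
by apply: Ht; rewrite mem_enum.
Qed.

Lemma small_lt (a b : R) : 0 < a -> small (fun t => t * b < a).
Proof.
move=> a0; have b1 : 0 < `|b| + 1 by rewrite ltr_wpDl.
exists (a / (`|b| + 1)); split; first by rewrite divr_gt0.
move=> t /andP[t0]; rewrite ltr_pdivlMr // => ta.
apply: le_lt_trans ta; rewrite ler_pM2l //.
by apply: le_trans (ler_norm b) _; rewrite lerDl.
Qed.

End Small.

Lemma seq_argmin (R : realType) (T : eqType) (s : seq T) (f : T -> R) (x0 : T) :
  x0 \in s -> exists2 x, x \in s & forall y, y \in s -> f x <= f y.
Proof.
move=> x0s; have i0 := x0s; rewrite -index_mem in i0.
case: (@arg_minP _ _ _ (Ordinal i0) xpredT (fun i => f (nth x0 s i))) => //.
move=> i _ Hi; exists (nth x0 s i); first exact: mem_nth.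
move=> y ys; have ii := ys; rewrite -index_mem in ii.
by have := Hi (Ordinal ii) isT; rewrite /= nth_index.
Qed.

(** * Inner products and ranks *)

Section Dot.
Variables (R : realType) (n : nat).
Local Notation vec := 'rV[R]_n.
Implicit Types (u v x d : vec).

Lemma dotE u v : dot u v = (u *m v^T) ord0 ord0.
Proof. by rewrite mxE; apply: eq_bigr => i _; rewrite mxE. Qed.

Lemma dotC u v : dot u v = dot v u.
Proof. by apply: eq_bigr => i _; rewrite mulrC. Qed.

Lemma dotDr u v w : dot u (v + w) = dot u v + dot u w.
Proof. by rewrite !dotE linearD mulmxDr mxE. Qed.

Lemma dotNr u v : dot u (- v) = - dot u v.
Proof. by rewrite !dotE linearN mulmxN mxE. Qed.

Lemma dotZr u a v : dot u (a *: v) = a * dot u v.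
Proof. by rewrite !dotE linearZ -scalemxAr mxE. Qed.

Lemma dot0r u : dot u 0 = 0.
Proof. by rewrite dotE linear0 mulmx0 mxE. Qed.

Lemma dotBr u v w : dot u (v - w) = dot u v - dot u w.
Proof. by rewrite dotDr dotNr. Qed.

Lemma dot_sumr u I (r : seq I) (Q : pred I) (F : I -> vec) :
  dot u (\sum_(i <- r | Q i) F i) = \sum_(i <- r | Q i) dot u (F i).
Proof. exact: (big_morph (dot u) (dotDr u) (dot0r u)). Qed.

Lemma dotDl u v w : dot (v + w) u = dot v u + dot w u.
Proof. by rewrite dotC dotDr !(dotC u). Qed.

Lemma dotNl u v : dot (- v) u = - dot v u.
Proof. by rewrite dotC dotNr dotC. Qed.

Lemma dotZl u a v : dot (a *: v) u = a * dot v u.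
Proof. by rewrite dotC dotZr dotC. Qed.

Lemma dot0l u : dot 0 u = 0.
Proof. by rewrite dotC dot0r. Qed.

Lemma dotBl u v w : dot (v - w) u = dot v u - dot w u.
Proof. by rewrite dotDl dotNl. Qed.

Lemma dot_suml u I (r : seq I) (Q : pred I) (F : I -> vec) :
  dot (\sum_(i <- r | Q i) F i) u = \sum_(i <- r | Q i) dot (F i) u.
Proof. by rewrite dotC dot_sumr; apply: eq_bigr => i _; rewrite dotC. Qed.

Lemma dot_ge0 u : 0 <= dot u u.
Proof. by apply: sumr_ge0 => i _; rewrite -expr2 sqr_ge0. Qed.

Lemma dot_eq0 u : dot u u = 0 -> u = 0.
Proof.
move=> u0; apply/rowP => i; rewrite mxE.
have /eqP : u ord0 i * u ord0 i = 0.
  by apply: (psumr_eq0P _ u0) => // j _; rewrite -expr2 sqr_ge0.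
by rewrite mulf_eq0 orbb => /eqP.
Qed.

Lemma dot_row m (A : 'M[R]_(m, n)) x i : dot (row i A) x = (A *m x^T) i ord0.
Proof. by rewrite dotE -row_mul mxE. Qed.

Lemma row_free_solve m (B : 'M[R]_(m, n)) (f : 'I_m -> R) :
  row_free B -> exists x, forall i, dot (row i B) x = f i.
Proof.
case/row_freeP => C BC; exists (C *m \col_i f i)^T => i.
by rewrite dot_row trmxK mulmxA BC mul1mx mxE.
Qed.

Lemma row_full_orth m (A : 'M[R]_(m, n)) d :
  row_full A -> (forall i, dot (row i A) d = 0) -> d = 0.
Proof.
case/row_fullP => C CA H; apply: trmx_inj.
rewrite -[d^T]mul1mx -CA -mulmxA; have -> : A *m d^T = 0.
  by apply/colP => i; rewrite -dot_row H mxE.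
by rewrite mulmx0 linear0.
Qed.

(** The columns of [cokermx A] are orthogonal to all rows of [A], so the hypothesis makes the
    cokernel vanish. *)
Lemma orth_row_full m (A : 'M[R]_(m, n)) :
  (forall d, (forall i, dot (row i A) d = 0) -> d = 0) -> row_full A.
Proof.
move=> H; rewrite -cokermx_eq0; apply/eqP/trmx_inj/row_matrixP => j.
rewrite linear0 row0; apply: H => i.
rewrite dot_row tr_row trmxK colE mulmxA mulmx_coker mul0mx mxE //.
Qed.

Lemma kernel_row_free m (A : 'M[R]_(m, n)) :
  (forall r : 'rV_m, r *m A = 0 -> r = 0) -> row_free A.
Proof.
move=> H; rewrite -kermx_eq0; apply/eqP/row_matrixP => i.
by rewrite row0; apply: H; rewrite -row_mul mulmx_ker row0.
Qed.

Lemma row_free_orth (B : 'M[R]_n) d :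
  row_free B -> (forall i, dot (row i B) d = 0) -> d = 0.
Proof. rewrite row_free_unit -row_full_unit; exact: row_full_orth. Qed.

End Dot.

Lemma dot_row_mx (R : realType) (n1 n2 : nat) (u1 v1 : 'rV[R]_n1) (u2 v2 : 'rV[R]_n2) :
  dot (row_mx u1 u2) (row_mx v1 v2) = dot u1 v1 + dot u2 v2.
Proof. by rewrite !dotE tr_row_mx mul_row_col mxE. Qed.

(** * Farkas' lemma for finitely generated cones *)

Section Farkas.
Variable R : realType.

(* Bartl's induction: if the last inequality is needed, some [z] violates only it,
   and projecting along [z] onto the kernel of [a] eliminates it. *)
Lemma farkas n (A : seq 'rV[R]_n) (b : 'rV[R]_n) :
  (forall x, (forall a, a \in A -> dot a x <= 0) -> dot b x <= 0) ->
  exists c : nat -> R, (forall i, 0 <= c i) /\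
    b = \sum_(i < size A) c i *: A`_i.
Proof.
have [m] := ubnP (size A); elim: m => // m IHm in A b *.
case: A => [|a A] /=; rewrite ltnS => szA HA.
  exists (fun _ => 0); split=> //; rewrite big_ord0; apply: dot_eq0.
  by apply/eqP; rewrite eq_le dot_ge0 andbT; apply: HA.
have [Hb|] := pselect (forall x, (forall a, a \in A -> dot a x <= 0) -> dot b x <= 0).
  have [c [c0 ->]] := IHm _ _ szA Hb.
  exists (fun i => if i is j.+1 then c j else 0); split; first by case.
  by rewrite big_ord_recl /= scale0r add0r.
move=> /existsNP[z0 /not_implyP[zA zb0]].
have {}zb0 : 0 < dot b z0 by rewrite ltNge; exact/negP.
have az0 : 0 < dot a z0.
  rewrite ltNge; apply/negP => az0.
  have : dot b z0 <= 0 by apply: HA => a'; rewrite inE => /predU1P[->|/zA].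
  by rewrite leNgt zb0.
pose z := (dot a z0)^-1 *: z0.
have azE : dot a z = 1 by rewrite dotZr mulVf // gt_eqF.
have {}zA a' : a' \in A -> dot a' z <= 0.
  by move=> /zA a'z; rewrite dotZr pmulr_rle0 // invr_gt0.
have zb : 0 < dot b z by rewrite dotZr mulr_gt0 // invr_gt0.
clearbody z.
have [||c [c0 Hc]] := IHm [seq a' - dot a' z *: a | a' <- A] (b - dot b z *: a).
- by rewrite size_map.
- move=> x Hx; pose x' := x - dot a x *: z.
  have -> : dot (b - dot b z *: a) x = dot b x'.
    by rewrite /x' dotBl dotZl dotBr dotZr; ring.
  apply: HA => a'; rewrite inE => /predU1P[->|a'A].
    by rewrite /x' dotBr dotZr azE mulr1 subrr.
  have := Hx _ (map_f _ a'A).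
  by rewrite /x' dotBr dotZr dotBl dotZl mulrC.
rewrite size_map in Hc.
(* The coefficient of [a] restores what the projection removed; it is nonnegative because [z]
   violates none of the inequalities from [A]. *)
pose c' := dot b z - \sum_(i < size A) c i * dot A`_i z.
exists (fun i => if i is j.+1 then c j else c'); split.
  case=> // ; rewrite subr_ge0; apply: le_trans (ltW zb); apply: sumr_le0 => i _.
  by rewrite mulr_ge0_le0 // zA // mem_nth.
rewrite big_ord_recl /=.
move/eqP: Hc; rewrite subr_eq => /eqP ->.
have -> : \sum_(i < size A) c i *: [seq a' - dot a' z *: a | a' <- A]`_i =
    \sum_(i < size A) (c i *: A`_i - (c i * dot A`_i z) *: a).
  by apply: eq_bigr => i _; rewrite (nth_map 0) // scalerBr scalerA.
rewrite sumrB -scaler_suml scalerBl -[RHS]addrA addrC; congr (_ + _).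
exact: addrC.
Qed.

End Farkas.

(** * Bounded polyhedra as convex hulls of their vertices *)

Section Hull.
Variables (R : realType) (n : nat).
Local Notation vec := 'rV[R]_n.
Implicit Types (V W X : seq vec) (u v x d : vec) (h : vec -> R).

Lemma mem_in_conv V v : v \in V -> in_conv V v.
Proof.
move=> vV; have vi := vV; rewrite -index_mem in vi.
exists (fun i => (i == Ordinal vi)%:R); split=> [i|]; first exact: ler0n.
split; first by rewrite (bigD1 (Ordinal vi)) //= eqxx big1 ?addr0 // => i /negbTE->.
rewrite (bigD1 (Ordinal vi)) //= eqxx scale1r nth_index //.
by rewrite big1 ?addr0 // => i /negbTE->; rewrite scale0r.
Qed.

Lemma in_conv_segment V x y (a b : R) :
  0 <= a -> 0 <= b -> a + b = 1 -> in_conv V x -> in_conv V y ->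
  in_conv V (a *: x + b *: y).
Proof.
move=> a0 b0 ab [c [c0 [c1 ->]]] [c' [c'0 [c'1 ->]]].
exists (fun i => a * c i + b * c' i); split=> [i|].
  by rewrite addr_ge0 // mulr_ge0.
split; first by rewrite big_split /= -!mulr_sumr c1 c'1 !mulr1.
rewrite !scaler_sumr -big_split /=.
by apply: eq_bigr => i _; rewrite !scalerA scalerDl.
Qed.

Lemma in_conv_dot_le V u x (b : R) :
  (forall v, v \in V -> dot u v <= b) -> in_conv V x -> dot u x <= b.
Proof.
move=> Hb [c [c0 [c1 ->]]]; rewrite dot_sumr -[b]mul1r -c1 mulr_suml.
by apply: ler_sum => i _; rewrite dotZr ler_wpM2l // Hb // mem_nth.
Qed.

Definition Hpoly X h x : Prop := forall u, u \in X -> dot u x <= h u.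

(** Triviality of the recession cone, which makes every [Hpoly X h] bounded. *)
Definition pos_spanning X : Prop :=
  forall d, (forall u, u \in X -> dot u d <= 0) -> d = 0.

(** For a point of [Hpoly X h] this is the property of being a vertex, stated by duality: the active
    normals span the space. *)
Definition active_spanning X h x : Prop :=
  forall d, (forall u, u \in X -> dot u x = h u -> dot u d = 0) -> d = 0.

Lemma finite_by_key (T : finType) (Q : vec -> Prop) (key : vec -> T) :
  (forall x y, Q x -> Q y -> key x = key y -> x = y) ->
  exists s : seq vec, forall x : vec, x \in s <-> Q x.
Proof.
move=> inj.
suff H : forall l : seq T, exists s : seq vec,
    forall x : vec, x \in s <-> Q x /\ key x \in l.
  have [s Hs] := H (enum T); exists s => x.
  by rewrite Hs mem_enum; split=> //; case.
elim=> [|t l [s Hs]]; first by exists [::] => x; split=> //; case.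
have [[y [Qy yt]]|no] := pselect (exists y, Q y /\ key y = t).
  exists (y :: s) => x; rewrite !inE; split.
    by case/predU1P => [->|/Hs [Qx ->]]; rewrite ?yt ?eqxx ?orbT.
  case=> Qx /predU1P[xt|xl]; first by rewrite (inj x y) ?eqxx // yt.
  by apply/orP; right; exact/Hs.
exists s => x; rewrite inE; split=> [/Hs[Qx ->]|]; first by rewrite orbT.
case=> Qx /predU1P[xt|xl]; last exact/Hs.
by case: no; exists x.
Qed.

(** A ratio test: the ray in direction [d] must meet a hyperplane because the recession cone is
    trivial, and at the first one met a constraint becomes active while the active ones stay so. *)
Lemma move_to_face X h x d :
  pos_spanning X -> Hpoly X h x -> d != 0 ->
  (forall u, u \in X -> dot u x = h u -> dot u d = 0) ->
  exists t, [/\ 0 < t, Hpoly X h (x + t *: d) &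
    (count (fun u => dot u (x + t *: d) != h u) X <
     count (fun u => dot u x != h u) X)%N].
Proof.
move=> spX Px d0 actd.
have [u0 u0X u0d] : exists2 u, u \in X & 0 < dot u d.
  apply: contrapT => no; case/eqP: d0; apply: spX => u uX.
  by rewrite leNgt; apply/negP => ud; apply: no; exists u.
have u0F : u0 \in [seq u <- X | 0 < dot u d] by rewrite mem_filter u0d.
have [u] := seq_argmin (fun u => (h u - dot u x) / dot u d) u0F.
rewrite mem_filter => /andP[ud uX] umin.
pose t := (h u - dot u x) / dot u d; exists t.
have tact v : v \in X -> dot v x = h v -> dot v (x + t *: d) = h v.
  by move=> vX vx; rewrite dotDr dotZr (actd v) // mulr0 addr0.
have uE : dot u (x + t *: d) = h u.
  by rewrite dotDr dotZr divfK ?gt_eqF // addrC subrK.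
have unact : dot u x != h u.
  by apply/eqP => /(actd _ uX) ud0; rewrite ud0 ltxx in ud.
have t0 : 0 < t by rewrite divr_gt0 // subr_gt0 lt_neqAle unact Px.
split=> //.
  move=> v vX; rewrite dotDr dotZr.
  have [vd|vd] := ltP 0 (dot v d); last first.
    by apply: le_trans (Px _ vX); rewrite gerDl pmulr_rle0.
  have : t <= (h v - dot v x) / dot v d by apply: umin; rewrite mem_filter vd.
  by rewrite ler_pdivlMr //; lra.
have := perm_to_rem uX => /permP cX; rewrite !cX /= uE eqxx unact /= ltnS.
have -> : count (fun v => dot v (x + t *: d) != h v) (rem u X) =
    count (predI (fun v => dot v x != h v)
                 (fun v => dot v (x + t *: d) != h v)) (rem u X).
  apply: eq_in_count => v vr /=; rewrite andbC; case: eqP => //= vE.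
  by apply/esym/eqP => /(tact v (mem_rem vr)).
by apply: sub_count => v /andP[].
Qed.

(** A vertex is determined by its active set, hence finiteness. A point that is not a vertex lies
    between two points with fewer inactive constraints, reached along [d] and [- d]; induct on the
    number of these constraints. *)
Theorem Hpoly_conv X h :
  pos_spanning X -> exists W : seq vec,
    (forall w : vec, w \in W <-> Hpoly X h w /\ active_spanning X h w) /\
    (forall x, Hpoly X h x -> in_conv W x).
Proof.
move=> spX.
pose act x := [set i : 'I_(size X) | dot X`_i x == h X`_i].
have [|W HW] := @finite_by_key _ (fun w => Hpoly X h w /\ active_spanning X h w) act.
  move=> x y [_ sx] _ xy; apply/eqP; rewrite -subr_eq0; apply/eqP/sx => u uX ux.
  have ui := uX; rewrite -index_mem in ui.
  move/setP/(_ (Ordinal ui)): xy; rewrite !inE /= nth_index // ux eqxx.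
  by move=> /esym/eqP uy; rewrite dotBr ux uy subrr.
exists W; split=> // x.
have [m] := ubnP (count (fun u => dot u x != h u) X).
elim: m => // m IHm in x *; rewrite ltnS => cm Px.
have [sx|] := pselect (active_spanning X h x).
  by apply: mem_in_conv; apply/HW.
move=> /existsNP[d /not_implyP[actd /eqP d0]].
have [t [t0 Pt ct]] := move_to_face spX Px d0 actd.
have d'0 : - d != 0 by rewrite oppr_eq0.
have [|s [s0 Ps cs]] := move_to_face spX Px d'0.
  by move=> u uX ux; rewrite dotNr actd // oppr0.
have ts0 : t + s != 0 by rewrite gt_eqF // addr_gt0.
have -> : x = (s / (t + s)) *: (x + t *: d) + (t / (t + s)) *: (x + s *: - d).
  rewrite !scalerDr addrACA -scalerDl !scalerA scalerN -scalerBl.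
  have -> : s / (t + s) + t / (t + s) = 1 by field.
  have -> : s / (t + s) * t - t / (t + s) * s = 0 by field.
  by rewrite scale1r scale0r addr0.
apply: in_conv_segment.
- by rewrite divr_ge0 // ltW // addr_gt0.
- by rewrite divr_ge0 // ltW // addr_gt0.
- by field.
- by apply: IHm => //; exact: leq_trans ct cm.
- by apply: IHm => //; exact: leq_trans cs cm.
Qed.

End Hull.

(** * Facets of a polytope *)

Section Facets.
Variables (R : realType) (n : nat).
Local Notation vec := 'rV[R]_n.
Implicit Types (V W X F : seq vec) (u v x d : vec) (h g : vec -> R).

Lemma unit_pos_multiple u v (k : R) :
  dot u u = 1 -> dot v v = 1 -> 0 < k -> u = k *: v -> u = v.
Proof.
move=> uu vv k0 E; have : k ^+ 2 = 1.
  by rewrite -uu E dotZl dotZr vv mulr1.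
move/eqP; rewrite -subr_eq0 subr_sqr_1 mulf_eq0 => /orP[|] /eqP k1.
  by rewrite E (_ : k = 1) ?scale1r //; lra.
by exfalso; lra.
Qed.

(** Excludes [n = 0], where [n.-1] would not be one less than [n]. *)
Lemma unit_dim_gt0 u : dot u u = 1 -> (0 < n)%N.
Proof.
rewrite lt0n; apply: contra_eqN => /eqP n0.
rewrite /dot big1 1?eq_sym ?oner_eq0 // => i _.
by have := ltn_ord i; rewrite {2}n0.
Qed.

Lemma orth_hyperplane_line (M : 'M[R]_(n.-1, n)) u v :
  row_free M -> dot u u = 1 ->
  (forall i, dot (row i M) u = 0) -> (forall i, dot (row i M) v = 0) ->
  v = dot v u *: u.
Proof.
move=> fM uu Mu Mv; have n0 := unit_dim_gt0 uu.
have ker w : (forall i, dot (row i M) w = 0) -> (w <= kermx M^T)%MS.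
  move=> Mw; apply/sub_kermxP/trmx_inj; rewrite trmx_mul trmxK linear0.
  by apply/colP => i; rewrite -dot_row Mw mxE.
have u0 : u != 0 by apply: contra_eq_neq uu => ->; rewrite dot0l eq_sym oner_eq0.
have : \rank u = \rank (kermx M^T).
  rewrite mxrank_ker mxrank_tr (eqP fM) rank_rV u0.
  by case: (n) n0 => // m _; rewrite /= subSnn.
move/eqP; rewrite (mxrank_leqif_sup (ker u Mu)) => /(submx_trans (ker v Mv)).
by case/sub_rVP => a ->; rewrite dotZl uu mulr1.
Qed.

Lemma orth_hyperplane_basis u :
  dot u u = 1 ->
  exists M : 'M[R]_(n.-1, n), row_free M /\ forall i, dot u (row i M) = 0.
Proof.
move=> uu; have n0 := unit_dim_gt0 uu.
have u0 : u != 0 by apply: contra_eq_neq uu => ->; rewrite dot0l eq_sym oner_eq0.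
have rk : \rank (kermx u^T) = n.-1 by rewrite mxrank_ker mxrank_tr rank_rV u0 subn1.
suff [M [fM Mu]] : exists M : 'M[R]_(n.-1, n), row_free M /\ (M <= kermx u^T)%MS.
  exists M; split=> // i; rewrite dotC dot_row.
  by move/sub_kermxP: Mu => ->; rewrite mxE.
by case: _ / rk; exists (row_base (kermx u^T)); rewrite row_base_free eq_row_base.
Qed.

Definition strictly_inside X h c : Prop := forall u, u \in X -> dot u c < h u.

Lemma strictly_inside_Hpoly X h c : strictly_inside X h c -> Hpoly X h c.
Proof. by move=> Hc u /Hc /ltW. Qed.

(** A mean of numbers bounded by [b] reaches [b] only if all of them do. The point [q] is chosen
    before [u] and [b], so that it serves all constraints at once. *)
Lemma barycentre F :
  F != [::] -> exists q, forall u b, (forall v, v \in F -> dot u v <= b) ->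
    dot u q <= b /\ (dot u q = b -> forall v, v \in F -> dot u v = b).
Proof.
move=> F0; have N0 : 0 < (size F)%:R :> R by rewrite ltr0n lt0n size_eq0.
exists ((size F)%:R^-1 *: \sum_(v <- F) v) => u b ub.
have E : (size F)%:R * (b - dot u ((size F)%:R^-1 *: \sum_(v <- F) v)) =
    \sum_(v <- F | v \in F) (b - dot u v).
  rewrite -big_seq dotZr dot_sumr mulrBr mulrA divff ?gt_eqF // mul1r.
  by rewrite sumrB big_const_seq count_predT iter_addr_0 mulr_natl.
have S0 v : v \in F -> 0 <= b - dot u v by move=> vF; rewrite subr_ge0 ub.
split=> [|uq v vF].
  by rewrite -subr_ge0 -(pmulr_rge0 _ N0) E sumr_ge0.
move: E; rewrite uq subrr mulr0 => /esym/eqP; rewrite psumr_eq0 //.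
by move=> /allP/(_ v vF); rewrite vF /= subr_eq0 => /eqP.
Qed.

(* [q] is the barycentre of the [n] affinely independent points of the facet:
   a constraint active there is active at all of them. *)
Lemma facet_active X h c u :
  strictly_inside X h c -> facet_normal (Hpoly X h) u ->
  exists q, [/\ Hpoly X h q, (forall z, Hpoly X h z -> dot u z <= dot u q),
    (exists2 a, a \in X & dot a q = h a) &
    forall a, a \in X -> dot a q = h a -> exists2 k, 0 < k & a = k *: u].
Proof.
move=> Hc [uu [x0 [M [P0 [max0 [PM fM]]]]]].
pose F := x0 :: [seq x0 + row i M | i <- enum 'I_n.-1].
have FM i : x0 + row i M \in F.
  by rewrite inE; apply/orP; right; apply/mapP; exists i; rewrite ?mem_enum.
have PF v : v \in F -> Hpoly X h v /\ dot u v = dot u x0.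
  by rewrite inE => /predU1P[->//|/mapP[i _ ->]]; exact: PM.
have [q Hq] := @barycentre F isT.
have Fq a : a \in X -> dot a q <= h a /\
    (dot a q = h a -> forall v, v \in F -> dot a v = h a).
  by move=> aX; apply: Hq => v /PF[Pv _]; exact: Pv.
have uq : dot u q = dot u x0.
  have [|le _] := Hq u (dot u x0); first by move=> v /PF[_ ->].
  have [|ge _] := Hq (- u) (- dot u x0); first by move=> v /PF[_]; rewrite dotNl => ->.
  by apply/eqP; rewrite eq_le le -lerN2 -dotNl.
have uM i : dot u (row i M) = 0.
  by have [_] := PM i; rewrite dotDr => /eqP; rewrite -subr_eq0 addrC addKr => /eqP.
have Pq : Hpoly X h q by move=> a /Fq[].
have maxq z : Hpoly X h z -> dot u z <= dot u q by rewrite uq; exact: max0.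
exists q; split=> //.
  apply: contrapT => no.
  (* With no active constraint at [q], a small step along [u] would stay in the polyhedron and
     increase [dot u]. *)
  have [t [t0 Pt]] : exists t, 0 < t /\ Hpoly X h (q + t *: u).
    apply/small_wit/small_all => a aX.
    have aq : 0 < h a - dot a q.
      rewrite subr_gt0 lt_neqAle Pq // andbT; apply/eqP => aq.
      by apply: no; exists a.
    apply: smallW (small_lt (dot a u) aq) => t _; rewrite dotDr dotZr; lra.
  by have := maxq _ Pt; rewrite dotDr dotZr uu; lra.
move=> a aX aq; have aF := (Fq a aX).2 aq.
have aMi i : dot (row i M) a = 0.
  by have := aF _ (FM i); rewrite dotDr aF ?mem_head // (dotC a); lra.
have aE : a = dot a u *: u.
  by apply: (orth_hyperplane_line fM) => // i; rewrite dotC.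
(* A nonpositive factor would make [a] minimal on the facet, against the strict inequality at
   [c]. *)
exists (dot a u) => //; rewrite ltNge; apply/negP => k0.
have /Hc := aX; rewrite -aq aE !dotZl ltNge.
by rewrite ler_wnM2l // maxq //; exact: strictly_inside_Hpoly.
Qed.

(** Only the constraint of [u] is tight at [q], so small moves from [q] inside its hyperplane remain
    in the polyhedron and span a facet. *)
Lemma facet_of_strict X h q u :
  dot u u = 1 -> u \in X -> dot u q = h u ->
  (forall v, v \in X -> v != u -> dot v q < h v) ->
  facet_normal (Hpoly X h) u.
Proof.
move=> uu uX uq Hq.
have Pq : Hpoly X h q.
  by move=> v vX; have [->|/Hq/ltW->] := eqVneq v u; rewrite ?uq.
have [M [fM uM]] := orth_hyperplane_basis uu.
have [t [t0 Pt]] : exists t, 0 < t /\ forall i, Hpoly X h (q + t *: row i M).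
  apply/small_wit/small_forall => i; apply: small_all => v vX.
  have [->|vu] := eqVneq v u.
    by apply: small_true => t; rewrite dotDr dotZr uM mulr0 addr0 uq.
  have vq : 0 < h v - dot v q by rewrite subr_gt0 Hq.
  apply: smallW (small_lt (dot v (row i M)) vq) => t _; rewrite dotDr dotZr; lra.
split=> //; exists q, (t *: M); split=> //; split=> [z Pz|]; first by rewrite uq Pz.
split=> [i|].
  by rewrite linearZ /=; split=> //; rewrite dotDr dotZr uM mulr0 addr0.
by rewrite /row_free mxrank_scale_nz // gt_eqF.
Qed.

(** For unit normals this says that [X] is exactly the set of facet normals and [g] gives the
    support numbers, in a form with strict inequalities that survives perturbation and convex
    combination. *)
Definition irredundant X g : Prop :=
  (exists c, strictly_inside X g c) /\
  forall u, u \in X -> exists q, dot u q = g u /\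
    forall v, v \in X -> v != u -> dot v q < g v.

Definition unit_normals X : Prop := forall u, u \in X -> dot u u = 1.

Lemma irredundant_facets X g u :
  unit_normals X -> irredundant X g ->
  facet_normal (Hpoly X g) u <-> u \in X.
Proof.
move=> X1 [[c Hc] HX]; split=> [uF|uX].
  have [q [_ _ [a aX aq] par]] := facet_active Hc uF.
  have [k k0 aE] := par a aX aq.
  by rewrite -(unit_pos_multiple (X1 a aX) uF.1 k0 aE).
have [q [uq Hq]] := HX u uX.
exact: (facet_of_strict (X1 u uX) uX uq Hq).
Qed.

Lemma irredundant_max X g u :
  irredundant X g -> u \in X -> exists q, Hpoly X g q /\ dot u q = g u.
Proof.
move=> [_ HX] uX; have [q [uq Hq]] := HX u uX; exists q; split=> // v vX.
by have [->|/Hq/ltW->] := eqVneq v u; rewrite ?uq.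
Qed.

Lemma strictly_inside_full_dim X g c :
  strictly_inside X g c -> full_dim (Hpoly X g).
Proof.
move=> Hc.
have [t [t0 Pt]] : exists t, 0 < t /\
    forall i, Hpoly X g (c + t *: row i (1%:M : 'M[R]_n)).
  apply/small_wit/small_forall => i; apply: small_all => v vX.
  have vq : 0 < g v - dot v c by rewrite subr_gt0 Hc.
  apply: smallW (small_lt (dot v (row i 1%:M)) vq) => t _; rewrite dotDr dotZr; lra.
exists c, (t *: 1%:M); split; first exact: strictly_inside_Hpoly.
split=> [i|]; first by rewrite linearZ /=; exact: Pt.
by rewrite /row_free mxrank_scale_nz ?mxrank1 // gt_eqF.
Qed.

Lemma Hpoly_is_polytope X g :
  pos_spanning X -> (exists x, Hpoly X g x) -> is_polytope (Hpoly X g).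
Proof.
move=> spX [c Pc]; have [W [HW convW]] := Hpoly_conv g spX.
exists W; split=> [|x]; first last.
  split; first exact: convW.
  by move=> Wx u uX; apply: in_conv_dot_le Wx => w /HW[+ _]; exact.
apply/eqP => W0; have := convW c Pc; rewrite W0 => -[a [_ []]].
by rewrite big_ord0 => /esym/eqP; rewrite oner_eq0.
Qed.

(** Take the barycentre of [n + 1] affinely independent points of [P]: a functional maximal there is
    constant on these points, hence zero. *)
Lemma full_dim_center (P : vec -> Prop) :
  full_dim P ->
  exists p, forall d, (forall x, P x -> dot d (x - p) <= 0) -> d = 0.
Proof.
case=> x0 [M [P0 [PM fM]]].
pose F := x0 :: [seq x0 + row i M | i <- enum 'I_n].
have FM i : x0 + row i M \in F.
  by rewrite inE; apply/orP; right; apply/mapP; exists i; rewrite ?mem_enum.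
have PF v : v \in F -> P v by rewrite inE => /predU1P[->//|/mapP[i _ ->]].
have [p Hp] := @barycentre F isT; exists p => d dP.
have [|_ /(_ erefl) dF] := Hp d (dot d p).
  by move=> v /PF/dP; rewrite dotBr subr_le0.
apply: (row_free_orth fM) => i.
by have := dF _ (FM i); rewrite dotDr (dF x0) ?mem_head // (dotC d (row i M)); lra.
Qed.

End Facets.

(** * From vertices to facets by polarity *)

Section PolytopeFacets.
Variables (R : realType) (n : nat).
Local Notation vec := 'rV[R]_n.
Implicit Types (V W X F : seq vec) (u v x d p : vec) (h g : vec -> R).

(** Lifting points to height [-1] turns affine inequalities into linear ones. Farkas' lemma then
    gives the coefficients, and the last coordinate shows that they sum to [1]. *)
Lemma in_conv_farkas V x :
  V != [::] ->
  (forall u b, (forall v, v \in V -> dot u v <= b) -> dot u x <= b) ->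
  in_conv V x.
Proof.
move=> V0 H; pose lift (v : vec) := row_mx v (const_mx (-1) : 'rV[R]_1).
have liftE v y : dot (lift v) y = dot (lsubmx y) v - rsubmx y ord0 ord0.
  rewrite -{1}(hsubmxK y) dot_row_mx dotC; congr (_ + _).
  by rewrite /dot big_ord1 mxE mulN1r.
have [y|c [c0]] := @farkas R _ [seq lift v | v <- V] (lift x).
  move=> Hy; rewrite liftE subr_le0; apply: H => v vV.
  by rewrite -subr_le0 -liftE; apply/Hy/map_f.
rewrite size_map => E; exists (fun i => c i); split=> //.
have {}E : lift x = \sum_(i < size V) c i *: lift V`_i.
  by rewrite E; apply: eq_bigr => i _; rewrite (nth_map 0).
split.
  have /(congr1 (fun m : 'rV__ => m ord0 ord0)) := congr1 (@rsubmx _ _ n 1) E.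
  rewrite row_mxKr linear_sum summxE mxE => /eqP; rewrite eqr_oppLR -sumrN => /eqP->.
  by apply: eq_bigr => i _; rewrite linearZ /= row_mxKr !mxE mulrN1 opprK.
have := congr1 (@lsubmx _ _ n 1) E; rewrite row_mxKl linear_sum => ->.
by apply: eq_bigr => i _; rewrite linearZ /= row_mxKl.
Qed.

(* The facets of [P] are the vertices of the polar body of [P] around an
   interior point [p]. *)
Theorem polytope_facets (P : vec -> Prop) :
  is_polytope P -> full_dim P ->
  exists X h, [/\ uniq X, unit_normals X, irredundant X h &
    forall x, P x <-> Hpoly X h x].
Proof.
move=> [V [V0 PV]] /full_dim_center[p cP].
have PVm v : v \in V -> P v by move=> vV; apply/PV/mem_in_conv.
pose V' := [seq v - p | v <- V].
have spV' : pos_spanning V'.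
  move=> d Hd; apply: cP => x /PV Vx; rewrite dotBr subr_le0.
  apply: in_conv_dot_le Vx => v vV; rewrite -subr_le0 -dotBr dotC.
  by apply/Hd/map_f.
have [W [HW convW]] := Hpoly_conv (fun _ => 1) spV'.
have PW w x : w \in W -> P x -> dot w (x - p) <= 1.
  move=> /HW[Dw _] /PV Vx; rewrite dotBr lerBlDr.
  apply: in_conv_dot_le Vx => v vV; rewrite -lerBlDr -dotBr dotC.
  by apply/Dw/map_f.
have WP x : (forall w, w \in W -> dot w (x - p) <= 1) -> P x.
  move=> Wx; apply/PV/in_conv_farkas => // u b ub.
  (* If [b] exceeds [dot u p], a positive multiple of [u] lies in the polar body, the hull of [W];
     otherwise the choice of [p] forces [u = 0]. *)
  have [b0|b0] := ltP 0 (b - dot u p).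
    have : in_conv W ((b - dot u p)^-1 *: u).
      apply: convW => _ /mapP[v vV ->]; rewrite dotC dotZl dotBr mulrC.
      by rewrite ler_pdivrMr // mul1r lerD2r ub.
    move/(@in_conv_dot_le _ _ W (x - p) _ 1); rewrite dotC dotZl dotBr mulrC.
    rewrite ler_pdivrMr // mul1r lerD2r; apply => w wW.
    by rewrite dotC Wx.
  have u0 : u = 0.
    apply: cP => y /PV Vy; rewrite dotBr subr_le0.
    apply: in_conv_dot_le Vy => v vV.
    by rewrite subr_le0 in b0; apply: le_trans b0; exact: ub.
  by case: V V0 ub {PV PVm V' spV' HW convW} => // v V _ /(_ v (mem_head _ _));
     rewrite u0 !dot0l.
have [h Hh] : exists h : vec -> R, forall u,
    (forall x, P x -> dot u x <= h u) /\ exists2 v, v \in V & dot u v = h u.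
  suff H : forall u, exists b, (forall x, P x -> dot u x <= b) /\
      exists2 v, v \in V & dot u v = b.
    by have [h] := choice H; exists h.
  move=> u; have [v0 v0V] : exists v, v \in V.
    by case: V V0 {PV PVm V' spV' HW convW} => // v V; exists v; exact: mem_head.
  have [v vV vmax] := seq_argmin (fun v => - dot u v) v0V.
  exists (dot u v); split; last by exists v.
  move=> x /PV; apply: in_conv_dot_le => y yV.
  by have := vmax y yV; rewrite lerN2.
pose nrm (w : vec) : vec := (Num.sqrt (dot w w))^-1 *: w.
have nrmE w x : dot (nrm w) x = (Num.sqrt (dot w w))^-1 * dot w x.
  exact: dotZl.
(* The origin has no active constraint in the polar body, so it can be one of the vertices [W] only
   when [n = 0]. *)
pose X := undup [seq nrm w | w <- W & w != 0].
have sq0 (w : vec) : w != 0 -> 0 < Num.sqrt (dot w w).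
  by move=> w0; rewrite sqrtr_gt0 lt_neqAle dot_ge0 andbT eq_sym;
     apply: contra_neq w0; exact: dot_eq0.
have XP u : u \in X -> exists w, [/\ w \in W, w != 0 & u = nrm w].
  by rewrite mem_undup => /mapP[w]; rewrite mem_filter => /andP[]; exists w.
have WX w : w \in W -> w != 0 -> nrm w \in X.
  by move=> wW w0; rewrite mem_undup; apply: map_f; rewrite mem_filter w0.
have actW w : w \in W -> w != 0 -> exists2 v, v \in V & dot w (v - p) = 1.
  move=> /HW[_ sw] w0; apply: contrapT => no; case/eqP: w0; apply: sw.
  move=> _ /mapP[v vV ->] vw; exfalso; apply: no.
  by exists v => //; rewrite dotC.
have hE w : w \in W -> w != 0 ->
    h (nrm w) = (Num.sqrt (dot w w))^-1 * (1 + dot w p).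
  move=> wW w0; have s0 := sq0 w w0; apply/eqP; rewrite eq_le; apply/andP; split.
    have [_ [v vV <-]] := Hh (nrm w).
    by rewrite nrmE ler_pM2l ?invr_gt0 // -lerBlDr -dotBr; apply/PW/PVm.
  have [v vV wv] := actW w wW w0.
  have -> : 1 + dot w p = dot w v by rewrite -wv dotBr subrK.
  by rewrite -nrmE; apply: (Hh _).1; exact: PVm.
have leE w x : w \in W -> w != 0 ->
    (dot (nrm w) x <= h (nrm w)) = (dot w (x - p) <= 1).
  by move=> wW w0; rewrite hE // nrmE ler_pM2l ?invr_gt0 ?sq0 // dotBr lerBlDr.
have eqE w x : w \in W -> w != 0 ->
    (dot (nrm w) x == h (nrm w)) = (dot w (x - p) == 1).
  move=> wW w0; rewrite hE // nrmE dotBr subr_eq.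
  by rewrite (inj_eq (mulfI _)) // invr_eq0 gt_eqF // sq0.
exists X, h; split=> [|u /XP[w [wW w0 ->]]||x].
- exact: undup_uniq.
- rewrite nrmE dotC nrmE -{3}(sqr_sqrtr (dot_ge0 w)) expr2.
  by have := sq0 w w0; move: (Num.sqrt _) => s s0; field; rewrite gt_eqF.
- split.
    exists p => u /XP[w [wW w0 ->]].
    by rewrite hE // nrmE ltr_pM2l ?invr_gt0 ?sq0 // ltrDr.
  move=> u /XP[w [wW w0 ->]].
  (* The points of [V] on the facet dual to [w]. A second constraint tight at their barycentre is
     tight at all of them, and as [w] is a vertex of the polar body it must be [w] itself. *)
  pose F := [seq v <- V | dot w (v - p) == 1].
  have [|q Hq] := @barycentre _ _ F.
    rewrite -has_filter; apply/hasP; have [v vV wv] := actW w wW w0.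
    by exists v => //; apply/eqP.
  have FV v : v \in F -> P v by rewrite mem_filter => /andP[_ /PVm].
  have FE v : v \in F -> dot (nrm w) v = h (nrm w).
    by rewrite mem_filter => /andP[wv _]; apply/eqP; rewrite eqE.
  exists q; split.
    apply/eqP; rewrite eq_le; apply/andP; split.
      by apply: (Hq _ _ _).1 => v vF; apply: (Hh _).1; exact: FV.
    have [|+ _] := Hq (- nrm w) (- h (nrm w)).
      by move=> v vF; rewrite dotNl lerN2 FE.
    by rewrite dotNl lerN2.
  move=> _ /XP[w' [w'W w'0 ->]] ww'.
  have [|le eq] := Hq (nrm w') (h (nrm w')).
    by move=> v vF; apply: (Hh _).1; exact: FV.
  rewrite lt_neqAle le andbT; apply/eqP => /eq Hv; case/eqP: ww'; congr nrm.
  apply/eqP; rewrite -subr_eq0; apply/eqP.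
  have /HW[_ sw] := wW; apply: sw => _ /mapP[v vV ->]; rewrite dotC => wv.
  have vF : v \in F by rewrite mem_filter wv eqxx.
  have /eqP := Hv v vF; rewrite eqE // => /eqP w'v.
  by rewrite dotC dotBl wv w'v subrr.
split=> [Px u _|Xx]; first exact: (Hh u).1.
apply: WP => w wW; have [->|w0] := eqVneq w 0; first by rewrite dot0l.
by rewrite -leE //; apply/Xx/WX.
Qed.

End PolytopeFacets.

(** * Arrangements with the same normals *)

Section Signs.
Variable R : realType.

Lemma small_neq0 (a b : R) : a != 0 -> small (fun t => a + t * b != 0).
Proof.
rewrite -normr_gt0 => a0; apply: smallW (small_lt `|b| a0) => t t0.
apply: contraTneq => /eqP; rewrite addr_eq0 => /eqP ->.
by rewrite normrN normrM (gtr0_norm t0) ltxx.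
Qed.

Lemma small_sg (a b : R) : a != 0 -> small (fun t => Num.sg (a + t * b) = Num.sg a).
Proof.
case: (ltgtP a 0) => // a0 _.
  have na0 : 0 < - a by rewrite oppr_gt0.
  apply: smallW (small_lt b na0) => t _ tb.
  by rewrite !ltr0_sg //; lra.
apply: smallW (small_lt (- b) a0) => t _ tb.
by rewrite !gtr0_sg //; move: tb; rewrite mulrN; lra.
Qed.

(** Signs as a finite type with three elements, so that sign vectors can be counted. *)
Definition sgo (r : R) : option bool := if r == 0 then None else Some (0 < r).

Definition sgo_val (o : option bool) : R :=
  if o is Some b then (if b then 1 else -1) else 0.

Lemma sgoK r : sgo_val (sgo r) = Num.sg r.
Proof.
rewrite /sgo; case: (ltgtP r 0) => [r0|r0|->] /=.
- by rewrite ltr0_sg.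
- by rewrite gtr0_sg.
- by rewrite sgr0.
Qed.

Lemma sg_sgo_val o : Num.sg (sgo_val o) = sgo_val o.
Proof. by case: o => [[]|] /=; rewrite ?sgrN ?sgr1 ?sgr0. Qed.

Lemma sgo_val_inj : injective sgo_val.
Proof. by case=> [[]|] [[]|] //= E; exfalso; lra. Qed.

End Signs.

(** * Sign vectors, stars of faces and generic offsets *)

Section Covectors.
Variables (R : realType) (n : nat).
Local Notation vec := 'rV[R]_n.
Implicit Types (X A : seq vec) (u v x d z : vec) (h g s : vec -> R).

Definition sign_vector X g x : vec -> R :=
  fun u => if u \in X then Num.sg (dot u x - g u) else 0.

(** By irredundance every offset [g u] is attained, so the support values in the definition of
    covectors are the offsets themselves. *)
Lemma arr_covectorP X g s :
  unit_normals X -> irredundant X g ->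
  arr_covector (Hpoly X g) s <-> exists x, s = sign_vector X g x.
Proof.
move=> X1 Xg; split=> [[x Hx]|[x ->]]; exists x.
  apply: funext => u; rewrite /sign_vector; case: ifPn => uX.
    have [y [Py [ymax ->]]] := (Hx u).1 ((irredundant_facets u X1 Xg).2 uX).
    have [q [Pq uq]] := irredundant_max Xg uX.
    suff -> : dot u y = g u by [].
    by apply/eqP; rewrite eq_le Py //= -uq ymax.
  by apply: (Hx u).2 => /(irredundant_facets u X1 Xg) uX'; rewrite uX' in uX.
move=> u; rewrite /sign_vector; split=> [/(irredundant_facets u X1 Xg) uX|uF].
  have [q [Pq uq]] := irredundant_max Xg uX.
  by exists q; rewrite uX uq; split=> //; split=> // z Pz; exact: Pz.
by case: ifPn => // /(irredundant_facets u X1 Xg).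
Qed.

Lemma cov_le_refl s : cov_le s s.
Proof. by move=> u; right. Qed.

Lemma cov_le_anti s (t : vec -> R) : cov_le s t -> cov_le t s -> s = t.
Proof.
move=> st ts; apply: funext => u.
by case: (st u) => // su; case: (ts u) => [tu|//]; rewrite su tu.
Qed.

(** The faces above [t0] are pulled back to [P] and pushed on to [Q']; since face orders are
    preserved and reflected and [cov_le] is antisymmetric, distinct faces stay distinct. *)
Lemma comb_equiv_star (P Q Q' : vec -> Prop) (J : Type) (F : J -> vec -> R) t0 :
  arr_comb_equiv P Q -> arr_comb_equiv P Q' -> injective F ->
  arr_covector Q t0 -> (forall j, arr_covector Q (F j) /\ cov_le t0 (F j)) ->
  exists t1 F', [/\ arr_covector Q' t1, injective F' &
    forall j : J, arr_covector Q' (F' j) /\ cov_le t1 (F' j)].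
Proof.
move=> [phi [p1 [p2 p3]]] [psi [q1 [q2 q3]]] Finj Qt0 HF.
have [s0 [Ps0 E0]] := p2 t0 Qt0.
have [S HS] := choice (fun j => p2 (F j) (HF j).1).
exists (psi s0), (psi \o S); split; first exact: q1.
  move=> j j' /= E; apply: Finj; rewrite -(HS j).2 -(HS j').2; congr phi.
  by apply: cov_le_anti; apply/(q3 _ _ (HS _).1 (HS _).1); rewrite E;
     exact: cov_le_refl.
move=> j; split; first exact/q1/(HS j).1.
apply/(q3 _ _ Ps0 (HS j).1)/(p3 _ _ Ps0 (HS j).1).
by rewrite E0 (HS j).2; exact: (HF j).2.
Qed.

Lemma dependence A :
  uniq A -> (n < size A)%N ->
  exists c : vec -> R, \sum_(u <- A) c u *: u = 0 /\ exists2 u, u \in A & c u != 0.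
Proof.
move=> uA sA; pose M := \matrix_(i < size A) A`_i.
have [r rM r0] : exists2 r : 'rV_(size A), r *m M = 0 & r != 0.
  apply: contrapT => no; suff /eqP rM : row_free M.
    by have := rank_leq_col M; rewrite rM leqNgt sA.
  apply: kernel_row_free => r rM; apply: contrapT => /eqP r0.
  by apply: no; exists r.
pose c u := \sum_(i < size A | A`_i == u) r ord0 i.
have cEo (j : 'I_(size A)) : c A`_j = r ord0 j.
  by rewrite /c (big_pred1 j) // => k; rewrite nth_uniq.
exists c; split.
  rewrite -[RHS]rM mulmx_sum_row (big_nth 0) big_mkord.
  by apply: eq_bigr => j _; rewrite cEo rowK.
have [j rj] : exists j, r ord0 j != 0.
  apply/existsP; rewrite -negb_forall; apply: contraNN r0 => /forallP r0.
  by apply/eqP/rowP => j; rewrite [RHS]mxE; apply/eqP/r0.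
by exists A`_j; rewrite ?mem_nth // cEo.
Qed.

(** The witness for [u0] moves outwards along [u0]; the other witnesses stay, since the raised
    offset only relaxes their inequalities. *)
Lemma irredundant_bump X g u0 :
  unit_normals X -> irredundant X g -> u0 \in X ->
  small (fun t => irredundant X (fun v => g v + t * (v == u0)%:R)).
Proof.
move=> X1 [[c Hc] HX] u0X.
have ge t v : 0 < t -> g v <= g v + t * (v == u0)%:R.
  by move=> t0; rewrite lerDl mulr_ge0 // ltW.
suff : small (fun t => forall u, u \in X -> exists q,
    dot u q = g u + t * (u == u0)%:R /\
    forall v, v \in X -> v != u -> dot v q < g v + t * (v == u0)%:R).
  apply: smallW => t t0 Ht; split=> //; exists c => u uX.
  by apply: lt_le_trans (Hc u uX) _; exact: ge.
apply: small_all => u uX; have [q [uq Hq]] := HX u uX.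
have [uu0|uu0] := eqVneq u u0; last first.
  apply: (smallW (Q := fun=> True)); last exact: small_true.
  move=> t t0 _; exists q; rewrite mulr0 addr0; split=> // v vX vu.
  by apply: lt_le_trans (Hq v vX vu) _; exact: ge.
suff : small (fun t => forall v, v \in X -> v != u -> dot v (q + t *: u) < g v).
  apply: smallW => t t0 Ht; exists (q + t *: u); split.
    by rewrite dotDr dotZr X1 // uq.
  by move=> v vX vu; apply: lt_le_trans (Ht v vX vu) _; exact: ge.
apply: small_all => v vX; have [->|vu] := eqVneq v u; first exact: small_true.
have vq : 0 < g v - dot v q by rewrite subr_gt0 Hq.
apply: smallW (small_lt (dot v u) vq) => t _; rewrite dotDr dotZr; lra.
Qed.

(** The linear forms are treated one at a time. If the new one vanishes at [g'], raising the offset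
    at a normal with nonzero coefficient repairs it, by an amount too small to spoil the earlier
    ones. *)
Lemma irredundant_avoid X g (I : eqType) (l : seq I) (A : I -> seq vec)
    (c : I -> vec -> R) :
  unit_normals X -> irredundant X g ->
  (forall i, i \in l -> uniq (A i) /\
     exists u, [/\ u \in A i, u \in X & c i u != 0]) ->
  exists g', irredundant X g' /\
    forall i, i \in l -> \sum_(u <- A i) c i u * g' u != 0.
Proof.
move=> X1 Xg; elim: l => [|i l IHl] Hl; first by exists g.
have [j jl|g' [Xg' Hg']] := IHl; first by apply: Hl; rewrite inE jl orbT.
have [i0|i0] := eqVneq (\sum_(u <- A i) c i u * g' u) 0; last first.
  by exists g'; split=> // j; rewrite inE => /predU1P[->|/Hg'].
have [uA [u [uAi uX cu]]] := Hl i (mem_head _ _).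
have shift t j : \sum_(v <- A j) c j v * (g' v + t * (v == u)%:R) =
    \sum_(v <- A j) c j v * g' v + t * \sum_(v <- A j) c j v * (v == u)%:R.
  by rewrite mulr_sumr -big_split; apply: eq_bigr => v _ /=; ring.
have := small_and (irredundant_bump X1 Xg' uX)
  (small_all (fun j jl => small_neq0 (\sum_(v <- A j) c j v * (v == u)%:R) (Hg' j jl))).
case/small_wit => t [t0 [Xt Ht]]; eexists; split; first exact: Xt.
move=> j; rewrite inE => /predU1P[->|jl]; rewrite shift; last exact: Ht.
rewrite i0 add0r mulf_neq0 ?(lt0r_neq0 t0) // (bigD1_seq u) //= eqxx mulr1.
by rewrite big1 ?addr0 // => v /negbTE->; rewrite mulr0.
Qed.

(** More than [n] normals are linearly dependent, and if their hyperplanes meet, the offsets satisfy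
    the same relation. One relation for each subset of [X], encoded as a mask, has to be avoided. *)
Lemma irredundant_generic X g :
  uniq X -> unit_normals X -> irredundant X g ->
  exists g', irredundant X g' /\
    forall x, (size [seq u <- X | dot u x == g' u] <= n)%N.
Proof.
move=> uX X1 Xg; pose A (m : (size X).-tuple bool) := mask m X.
have [c Hc] : exists c : (size X).-tuple bool -> vec -> R, forall m,
    (n < size (A m))%N -> \sum_(u <- A m) c m u *: u = 0 /\
      exists2 u, u \in A m & c m u != 0.
  suff H : forall m, exists c : vec -> R,
      (n < size (A m))%N -> \sum_(u <- A m) c u *: u = 0 /\
      exists2 u, u \in A m & c u != 0.
    by have [c] := choice H; exists c.
  move=> m; have [sA|sA] := ltnP n (size (A m)); last by exists (fun=> 0).
  by have [c Hc] := dependence (mask_uniq uX m) sA; exists c.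
pose l := [seq m <- enum {: (size X).-tuple bool} | (n < size (A m))%N].
have [m|g' [Xg' Hg']] := irredundant_avoid (l := l) (A := A) (c := c) X1 Xg.
  rewrite mem_filter => /andP[sA _]; split; first exact: mask_uniq.
  have [_ [u uA cu]] := Hc m sA; exists u; split=> //; exact: mem_mask uA.
exists g'; split=> // x; rewrite leqNgt; apply/negP => sF.
pose m := [tuple of map (fun u => dot u x == g' u) (in_tuple X)].
have AE : A m = [seq u <- X | dot u x == g' u] by rewrite filter_mask.
have /Hg'/eqP : m \in l by rewrite mem_filter AE sF mem_enum.
apply; have [|c0 _] := Hc m; first by rewrite AE.
have := congr1 (fun v => dot v x) c0; rewrite dot0l dot_suml; apply: etrans.
rewrite AE big_seq [RHS]big_seq; apply: eq_bigr => u.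
by rewrite mem_filter => /andP[/eqP <- _]; rewrite dotZl.
Qed.

(** A face above [t] can differ from [t] only on the normals where [t] vanishes, at most [n] in
    number, so it is encoded by [n] signs. *)
Lemma generic_star_card X g (J : finType) (F : J -> vec -> R) t :
  unit_normals X -> irredundant X g ->
  (forall x, (size [seq u <- X | dot u x == g u] <= n)%N) ->
  injective F -> arr_covector (Hpoly X g) t ->
  (forall j, arr_covector (Hpoly X g) (F j) /\ cov_le t (F j)) ->
  (#|J| <= #|{ffun 'I_n -> option bool}|)%N.
Proof.
move=> X1 Xg gen Finj tc HF; pose A := [seq u <- X | t u == 0].
have sA : (size A <= n)%N.
  have [x tE] := (arr_covectorP t X1 Xg).1 tc.
  rewrite /A (@eq_in_filter _ _ (fun u => dot u x == g u)) // => u uX.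
  by rewrite tE /sign_vector uX sgr_eq0 subr_eq0.
pose code j := [ffun i : 'I_n => sgo (F j A`_i)].
apply: (@leq_card _ _ code) => j j' Ejj; apply: Finj; apply: funext => u.
have [tu|tu] := eqVneq (t u) 0; last first.
  suff Fu k : F k u = t u by rewrite !Fu.
  by case: ((HF k).2 u) => // tu0; rewrite tu0 eqxx in tu.
have [x Ex] := (arr_covectorP _ X1 Xg).1 (HF j).1.
have [x' Ex'] := (arr_covectorP _ X1 Xg).1 (HF j').1.
have [uX|uX] := boolP (u \in X); last by rewrite Ex Ex' /sign_vector (negbTE uX).
have uA : u \in A by rewrite mem_filter tu eqxx.
have iA : (index u A < n)%N by apply: leq_trans sA; rewrite index_mem.
have /(congr1 (@sgo_val R)) : sgo (F j u) = sgo (F j' u).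
  by have /ffunP/(_ (Ordinal iA)) := Ejj; rewrite !ffunE /= nth_index.
by rewrite !sgoK Ex Ex' /sign_vector uX !sgr_id.
Qed.

(** A short step from [z] along [d] keeps the sides of the hyperplanes missing [z]; thus each
    direction yields a face in the star of [z]. *)
Lemma local_covector X g z d :
  exists x, forall u, u \in X -> Num.sg (dot u x - g u) =
    if dot u z == g u then Num.sg (dot u d) else Num.sg (dot u z - g u).
Proof.
suff /small_wit[t [_ Ht]] : small (fun t => forall u, u \in X ->
    Num.sg (dot u (z + t *: d) - g u) =
    if dot u z == g u then Num.sg (dot u d) else Num.sg (dot u z - g u)).
  by exists (z + t *: d).
apply: small_all => u uX; case: eqVneq => [uz|].
  apply: (smallW (Q := fun=> True)); last exact: small_true.
  by move=> t t0 _; rewrite dotDr dotZr uz addrC addKr sgrM gtr0_sg ?mul1r.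
rewrite -subr_eq0 => uz; apply: smallW (small_sg (dot u d) uz) => t _ <-.
by congr Num.sg; rewrite dotDr dotZr; ring.
Qed.

End Covectors.

(** * Consequences of the equivalence of all arrangements *)

Section StronglyMonotypic.
Variables (R : realType) (n : nat) (P : 'rV[R]_n -> Prop) (X : seq 'rV[R]_n).
Local Notation vec := 'rV[R]_n.
Hypotheses (uX : uniq X) (X1 : unit_normals X).
Hypothesis equivP : forall g, irredundant X g -> arr_comb_equiv P (Hpoly X g).

(* A concurrent basis together with one more hyperplane gives a point whose star has
   more than [3 ^ n] faces, whereas for generic offsets every star has at most [3 ^ n]. *)
Lemma concurrent_basis g (B : 'M[R]_n) z u0 :
  irredundant X g -> row_free B -> (forall i, row i B \in X) ->
  (forall i, dot (row i B) z = g (row i B)) ->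
  u0 \in X -> dot u0 z = g u0 -> exists i, u0 = row i B.
Proof.
move=> Xg fB BX Bz u0X u0z; apply: contrapT => nB.
have Bu : B \in unitmx by rewrite -row_free_unit.
pose a := u0 *m invmx B.
have u0E : u0 = \sum_i a ord0 i *: row i B by rewrite -mulmx_sum_row mulmxKV.
have u0d d : dot u0 d = \sum_i a ord0 i * dot (row i B) d.
  by rewrite {1}u0E dot_suml; apply: eq_bigr => i _; rewrite dotZl.
have [i ai] : exists i, a ord0 i != 0.
  apply: contrapT => no; have := X1 u0X; rewrite u0d big1 => [/esym/eqP|i _].
    by rewrite oner_eq0.
  by have [->|ai] := eqVneq (a ord0 i) 0; [rewrite mul0r|case: no; exists i].
(* Otherwise [u0] is a multiple of one row: a positive factor would make them equal, and a negative
   one contradicts the interior point. *)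
have [j ji aj] : exists2 j, j != i & a ord0 j != 0.
  apply: contrapT => no.
  have u0i : u0 = a ord0 i *: row i B.
    rewrite u0E (bigD1 i) //= big1 ?addr0 // => j ji.
    by have [->|aj] := eqVneq (a ord0 j) 0; [rewrite scale0r|case: no; exists j].
  have [a0|a0|a0] := ltgtP (a ord0 i) 0; last by rewrite a0 eqxx in ai.
    have [[c Hc] _] := Xg; have := Hc u0 u0X.
    rewrite -u0z u0i !dotZl Bz ltr_nM2l // => cb.
    by have := lt_trans cb (Hc _ (BX i)); rewrite ltxx.
  by apply: nB; exists i; exact: unit_pos_multiple (X1 u0X) (X1 (BX i)) a0 u0i.
(* Prescribed values on the basis, for which [u0] takes the value [l - 1]: for [l = 1] and [l = 2]
   the signs on the basis agree, but the sign on [u0] is [0] and [1] respectively. *)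
pose f (l : R) k := l * (k == i)%:R / a ord0 i - (k == j)%:R / a ord0 j.
have u0f l d : (forall k, dot (row k B) d = f l k) -> dot u0 d = l - 1.
  move=> Bd; rewrite u0d (bigD1 i) //= (bigD1 j) //= big1 => [|k /andP[/negbTE ki /negbTE kj]].
    rewrite !Bd /f !eqxx (negbTE ji) (eq_sym i) (negbTE ji) /=; field.
    by rewrite ai aj.
  by rewrite Bd /f ki kj mulr0 !mul0r subrr mulr0.
have [d1 Bd1] := row_free_solve (f 1) fB.
have [d2 Bd2] := row_free_solve (f 2) fB.
have sgf k : Num.sg (f 2 k) = Num.sg (f 1 k).
  rewrite /f; case: eqVneq => [->|ki]; last by rewrite !mulr0.
  by rewrite (eq_sym i) (negbTE ji) !mul0r !subr0 !mulr1 !sgrM gtr0_sg ?sgr1.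
pose T := {ffun 'I_n -> option bool}.
have [D HD] := choice (fun e : T => row_free_solve (fun i => sgo_val R (e i)) fB).
pose e1 : T := [ffun k => sgo (f 1 k)].
(* The directions [D e] already realise all [3 ^ n] sign patterns on the basis; [d'] repeats the
   pattern [e1] with another sign on [u0], which gives one more face. *)
have [d' Bd' u0d'] : exists2 d', forall k, Num.sg (dot (row k B) d') = sgo_val R (e1 k) &
    Num.sg (dot u0 d') != Num.sg (dot u0 (D e1)).
  have [D0|D0] := eqVneq (Num.sg (dot u0 (D e1))) 0.
    exists d2; first by move=> k; rewrite Bd2 ffunE sgoK sgf.
    by rewrite D0 (u0f 2) // sgr_eq0 (_ : 2 - 1 = 1) ?oner_eq0 //; ring.
  exists d1; first by move=> k; rewrite Bd1 ffunE sgoK.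
  by rewrite (u0f 1) // subrr sgr0 eq_sym.
pose dir (o : option T) := if o is Some e then D e else d'.
have [x Hx] := choice (fun o => local_covector X g z (dir o)).
pose F o := sign_vector X g (x o).
have FB o k : F o (row k B) = Num.sg (dot (row k B) (dir o)).
  by rewrite /F /sign_vector BX Hx // Bz eqxx.
have Fu0 o : F o u0 = Num.sg (dot u0 (dir o)).
  by rewrite /F /sign_vector u0X Hx // u0z eqxx.
have FBS e k : F (Some e) (row k B) = sgo_val R (e k).
  by rewrite FB /= HD sg_sgo_val.
have notNone e : F (Some e) <> F None.
  move=> E; have ee1 : e = e1.
    apply/ffunP => k; apply: (@sgo_val_inj R); rewrite -FBS E FB.
    exact: Bd'.
  by move/eqP: u0d'; apply; rewrite -(Fu0 None) -E Fu0 ee1.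
have Finj : injective F.
  move=> [e|] [e'|] // E; [|by case: (notNone e)|by case: (notNone e')].
  congr Some; apply/ffunP => k; apply: (@sgo_val_inj R).
  by rewrite -!FBS E.
have zc : arr_covector (Hpoly X g) (sign_vector X g z).
  by apply/arr_covectorP => //; exists z.
have Fc o : arr_covector (Hpoly X g) (F o) /\ cov_le (sign_vector X g z) (F o).
  split; first by apply/arr_covectorP => //; exists (x o).
  move=> u; rewrite /F /sign_vector; case: ifPn => [uX'|]; last by left.
  rewrite Hx //; case: eqVneq => [->|]; last by right.
  by left; rewrite subrr sgr0.
have [g' [Xg' gen]] := irredundant_generic uX X1 Xg.
have [t [F' [tc F'inj F'c]]] :=
  comb_equiv_star (equivP Xg) (equivP Xg') Finj zc Fc.
have := generic_star_card X1 Xg' gen F'inj tc F'c.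
by rewrite card_option ltnn.
Qed.

Lemma irredundant_convex g0 g1 (t : R) :
  irredundant X g0 -> irredundant X g1 -> 0 <= t <= 1 ->
  irredundant X (fun u => (1 - t) * g0 u + t * g1 u).
Proof.
move=> [[c0 Hc0] H0] [[c1 Hc1] H1] /andP[t0 t1].
have lt_comb (a b c d : R) : a < b -> c < d ->
    (1 - t) * a + t * c < (1 - t) * b + t * d.
  move=> ab cd; have [t1'|t1'] := ltP t 1.
    by apply: ltr_leD; [rewrite ltr_pM2l ?subr_gt0|rewrite ler_wpM2l // ltW].
  by rewrite (_ : t = 1) ?subrr ?mul0r ?add0r ?mul1r //; apply/eqP; rewrite eq_le t1.
split.
  exists ((1 - t) *: c0 + t *: c1) => u uX'.
  by rewrite dotDr !dotZr lt_comb ?Hc0 ?Hc1.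
move=> u uX'; have [q0 [uq0 Hq0]] := H0 u uX'; have [q1 [uq1 Hq1]] := H1 u uX'.
exists ((1 - t) *: q0 + t *: q1); rewrite dotDr !dotZr uq0 uq1; split=> // v vX vu.
by rewrite dotDr !dotZr lt_comb ?Hq0 ?Hq1.
Qed.

(* Along the segment from [g0] to [g1] the slack of any other normal at the moving
   vertex is affine and never vanishes. *)
Lemma vertex_transfer g0 g1 (B : 'M[R]_n) w z :
  irredundant X g0 -> irredundant X g1 ->
  row_free B -> (forall i, row i B \in X) ->
  (forall i, dot (row i B) w = g0 (row i B)) ->
  (forall i, dot (row i B) z = g1 (row i B)) ->
  Hpoly X g0 w -> Hpoly X g1 z.
Proof.
move=> Xg0 Xg1 fB BX Bw Bz Pw u uX'; rewrite leNgt; apply/negP => uz.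
pose s0 := g0 u - dot u w; pose s1 := g1 u - dot u z.
have s00 : 0 <= s0 by rewrite subr_ge0 Pw.
have s10 : s1 < 0 by rewrite subr_lt0.
have ds : 0 < s0 - s1 by rewrite subr_gt0 (lt_le_trans s10).
(* The parameter where the affine slack of [u] vanishes. Concurrency there makes [u] a row of [B],
   whose slack at [z] is zero and not negative. *)
pose t := s0 / (s0 - s1).
have t01 : 0 <= t <= 1.
  by rewrite divr_ge0 ?(ltW ds) //= ler_pdivrMr // mul1r lerDl oppr_ge0 ltW.
have ts : (1 - t) * s0 + t * s1 = 0 by rewrite /t; field; rewrite gt_eqF.
have [||||||i uE] := concurrent_basis (g := fun u => (1 - t) * g0 u + t * g1 u)
    (B := B) (z := (1 - t) *: w + t *: z) (u0 := u) => //.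
- exact: irredundant_convex.
- by move=> i; rewrite dotDr !dotZr Bw Bz.
- by rewrite dotDr !dotZr; move: ts; rewrite /s0 /s1; lra.
by move: s10; rewrite /s1 uE Bz subrr ltxx.
Qed.

End StronglyMonotypic.

(** * Skeletons *)

Section Simplex.
Variables (R : realType) (n : nat) (s : seq 'rV[R]_n) (l : 'I_(size s) -> R).
Hypotheses (l0 : forall i, 0 < l i) (l1 : \sum_i l i = 1).
Hypothesis ls : \sum_i l i *: s`_i = 0.

Lemma simplex_argmin (f : 'I_(size s) -> R) : exists j, forall i, f j <= f i.
Proof.
have [j0 _] : exists j0 : 'I_(size s), True.
  apply: contrapT => no; have := l1; rewrite big1 => [/esym/eqP|i].
    by rewrite oner_eq0.
  by case: no; exists i.
have [j _ jmin] := seq_argmin f (mem_enum 'I_(size s) j0).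
by exists j => i; apply: jmin; rewrite mem_enum.
Qed.

(** Subtract from the coefficients the largest multiple of the positive relation [l] that keeps them
    nonnegative; one of them becomes zero. *)
Lemma simplex_cone v : in_span s v ->
  exists (m : 'I_(size s) -> R) j,
    [/\ forall i, 0 <= m i, m j = 0 & v = \sum_i m i *: s`_i].
Proof.
case=> c ->; have [j jmin] := simplex_argmin (fun i => c i / l i).
exists (fun i => c i - c j / l j * l i), j; split=> [i||].
- by rewrite subr_ge0 -ler_pdivlMr.
- by rewrite divfK ?subrr // gt_eqF.
under [RHS]eq_bigr do rewrite scalerBl -scalerA.
by rewrite sumrB -scaler_sumr ls scaler0 subr0.
Qed.

(** By affine independence every linear relation is a multiple of [l], whose entries are all
    nonzero. *)
Lemma simplex_free (c : 'I_(size s) -> R) j :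
  aff_indep s -> \sum_i c i *: s`_i = 0 -> c j = 0 -> forall i, c i = 0.
Proof.
move=> aff cs cj; pose mu := \sum_i c i.
have cE i : c i - mu * l i = 0.
  apply: (aff (fun i => c i - mu * l i)).
    by rewrite sumrB -mulr_sumr l1 mulr1 subrr.
  under eq_bigr do rewrite scalerBl -scalerA.
  by rewrite sumrB -scaler_sumr ls scaler0 subr0 cs.
have mu0 : mu = 0.
  have /eqP := cE j; rewrite cj sub0r oppr_eq0 mulf_eq0 (gt_eqF (l0 j)) orbF.
  by move/eqP.
by move=> i; have := cE i; rewrite mu0 mul0r subr0.
Qed.

End Simplex.

(** * The product of simplices and the covering *)

Section Skeleton.
Variables (R : realType) (n k : nat) (Xs : 'I_k -> seq 'rV[R]_n).
Local Notation vec := 'rV[R]_n.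
Local Notation idx i := 'I_(size (Xs i)).
Local Notation y i j := ((Xs i)`_(nat_of_ord (j : idx i))).
Implicit Types (u v x z p : vec) (h g : vec -> R).

(** A choice of the normal left out in each [Xs i]; these choices index the vertices of the product
    of simplices. *)
Definition vertex_choice := fprod (fun i => idx i : finType).
Local Notation coefs := (forall i, idx i -> R).

Variable l : coefs.
Hypotheses (l0 : forall i j, 0 < l (i := i) j) (l1 : forall i, \sum_j l (i := i) j = 1).
Hypothesis ly : forall i, \sum_j l (i := i) j *: y i j = 0.
Hypothesis affXs : forall i, aff_indep (Xs i).
Hypothesis dsXs : direct_sum_full Xs.

Definition comb (m : coefs) : vec := \sum_i \sum_j m i j *: y i j.

Lemma dot_comb (m : coefs) x :
  dot (comb m) x = \sum_i \sum_j m i j * dot (y i j) x.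
Proof.
rewrite dot_suml; apply: eq_bigr => i _; rewrite dot_suml.
by apply: eq_bigr => j _; rewrite dotZl.
Qed.

(** Completeness of the normal fan of the product of simplices, obtained summand by summand. *)
Lemma skeleton_cone v :
  exists (m : coefs) (s : vertex_choice),
    [/\ forall i j, 0 <= m i j, forall i, m i (s i) = 0 & v = comb m].
Proof.
have [w [wspan ->]] := dsXs.1 v.
have H i := simplex_cone (@l0 i) (l1 i) (ly i) (wspan i).
pose m i := projT1 (cid (H i)); pose s i := projT1 (cid (projT2 (cid (H i)))).
have Hm i : [/\ forall j, 0 <= m i j, m i (s i) = 0 & w i = \sum_j m i j *: y i j].
  exact: (projT2 (cid (projT2 (cid (H i))))).
exists m, [fprod i => s i]; split=> [i j|i|].
- by have [] := Hm i.
- by rewrite fprodE; have [] := Hm i.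
by apply: eq_bigr => i _; have [] := Hm i.
Qed.

Lemma skeleton_free (c : coefs) (s : vertex_choice) :
  comb c = 0 -> (forall i, c i (s i) = 0) -> forall i j, c i j = 0.
Proof.
move=> c0 cs i; apply: (simplex_free (@l0 i) (l1 i) (ly i) (j := s i)) => //.
by apply: (dsXs.2 (fun i => \sum_j c i j *: y i j)) => // i'; exists (c i').
Qed.

Local Notation pairs := {i : 'I_k & idx i}.

Definition off (s : vertex_choice) : {set pairs} := [set t : pairs | tagged t != s (tag t)].

Definition off_mx (s : vertex_choice) : 'M[R]_(#|off s|, n) :=
  \matrix_q y (tag (enum_val q)) (tagged (enum_val q)).

Lemma off_mx_free s : row_free (off_mx s).
Proof.
apply: kernel_row_free => r rN.
(* Coefficients carried back to the double index; an omitted normal receives the empty sum, so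
   [skeleton_free] applies. *)
pose c i (j : idx i) := \sum_(q | enum_val q == Tagged (fun i => idx i) j) r ord0 q.
have c0 : comb c = 0.
  rewrite -rN mulmx_sum_row /comb.
  rewrite (sig_big_dep xpredT (fun _ => xpredT) (fun i j => c i j *: y i j)) /=.
  transitivity (\sum_(t : pairs) \sum_(q | enum_val q == t)
      r ord0 q *: y (tag (enum_val q)) (tagged (enum_val q))).
    apply: eq_bigr => -[i j] _ /=; rewrite scaler_suml.
    by apply: eq_bigr => q /eqP ->.
  rewrite (exchange_big_dep xpredT) //=; apply: eq_bigr => q _.
  by rewrite (big_pred1 (enum_val q)) ?rowK // => t /=; rewrite eq_sym.
have cs i : c i (s i) = 0.
  rewrite /c big_pred0 // => q; apply/eqP => qE.
  by have := enum_valP q; rewrite qE inE /= eqxx.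
apply/rowP => q; rewrite [RHS]mxE.
have <- := skeleton_free c0 cs (tagged (enum_val q)).
rewrite /c (big_pred1 q) // => q'; case: (enum_val q) (inj_eq enum_val_inj q' q).
by move=> i j /= ->.
Qed.

Lemma skeleton_vertex h (s : vertex_choice) :
  exists v, forall i j, j != s i -> dot (y i j) v = h (y i j).
Proof.
have [v Hv] := row_free_solve
  (fun q => h (y (tag (enum_val q)) (tagged (enum_val q)))) (off_mx_free s).
exists v => i j js; pose t := Tagged (fun i => idx i) j.
have tO : t \in off s by rewrite inE.
by have := Hv (enum_rank_in tO t); rewrite rowK enum_rankK_in.
Qed.

(** The normals kept by [s] are independent, so the numbers [size (Xs i) - 1] add up to at most [n];
    conclude with [m + 1 <= 2 ^ m] in each factor. *)
Lemma skeleton_card (s : vertex_choice) : (\prod_(i < k) size (Xs i) <= 2 ^ n)%N.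
Proof.
have cO : (\sum_(i < k) (size (Xs i)).-1 <= n)%N.
  have := rank_leq_col (off_mx s); rewrite (eqP (off_mx_free s)).
  rewrite -sum1_card; congr (_ <= _)%N.
  rewrite (eq_bigl (fun t : pairs => tagged t != s (tag t))) => [|t]; last by rewrite inE.
  rewrite -(sig_big_dep xpredT (fun i j => j != s i) (fun _ _ => 1%N)).
  apply: eq_bigr => i _; rewrite sum1_card.
  by have := cardC1 (s i); rewrite card_ord => <-.
apply: leq_trans (leq_pexp2l (isT : (0 < 2)%N) cO); rewrite expn_sum.
apply: leq_prod => i _; case: (size (Xs i)) => //= m; exact: ltn_expl.
Qed.

(** In each factor the sum of the slacks weighted by [l] does not depend on the point. It is
    nonnegative at [p], and at [v] only the omitted normal contributes to it. *)
Lemma skeleton_vertex_le h (s : vertex_choice) v p :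
  (forall i j, dot (y i j) p <= h (y i j)) ->
  (forall i j, j != s i -> dot (y i j) v = h (y i j)) ->
  forall i j, dot (y i j) v <= h (y i j).
Proof.
move=> Hp Hv i j; have [->|/Hv->//] := eqVneq j (s i).
have sl x : \sum_j l j * (h (y i j) - dot (y i j) x) = \sum_j l j * h (y i j).
  under eq_bigr do rewrite mulrBr -dotZl.
  by rewrite sumrB -dot_suml ly dot0l subr0.
have : 0 <= \sum_j l j * (h (y i j) - dot (y i j) v).
  rewrite sl -(sl p); apply: sumr_ge0 => j' _.
  by rewrite mulr_ge0 ?subr_ge0 // ltW.
rewrite (bigD1 (s i)) //= big1 => [|j' /Hv->]; last by rewrite subrr mulr0.
by rewrite addr0 pmulr_rge0 // subr_ge0.
Qed.

Variables (X : seq vec) (h : vec -> R).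
Hypotheses (uniqX : uniq X) (X1 : unit_normals X) (Xh : irredundant X h).
Hypothesis equivX : forall g, irredundant X g -> arr_comb_equiv (Hpoly X h) (Hpoly X g).
Hypothesis yX : forall i (j : idx i), y i j \in X.

(** The positive relation [l] forces nonpositive products with the normals of [Xs i] to vanish, and
    the skeleton spans the space. *)
Lemma skeleton_pos_spanning : pos_spanning X.
Proof.
move=> d Hd; have yd i (j : idx i) : dot (y i j) d = 0.
  have H : \sum_j l j * - dot (y i j) d = 0.
    under eq_bigr do rewrite mulrN -dotZl.
    by rewrite sumrN -dot_suml ly dot0l oppr0.
  have := psumr_eq0P _ H (i := j); rewrite mulrN => E.
  have /eqP : - (l j * dot (y i j) d) = 0.
    by apply: E => // j' _; rewrite mulr_ge0 ?oppr_ge0 ?Hd // ltW.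
  by rewrite oppr_eq0 mulf_eq0 gt_eqF //= => /eqP.
apply: dot_eq0; have [m [s [_ _ dE]]] := skeleton_cone d.
by rewrite {1}dE dot_comb big1 // => i _; rewrite big1 // => j _; rewrite yd mulr0.
Qed.

Lemma vertex_basis g w :
  Hpoly X g w -> active_spanning X g w ->
  exists B : 'M[R]_n, [/\ row_free B, forall i, row i B \in X &
    forall i, dot (row i B) w = g (row i B)].
Proof.
move=> Pw sw; pose A := [seq u <- X | dot u w == g u].
pose M := \matrix_(i < size A) A`_i.
have fM : row_full M.
  apply: orth_row_full => d Md; apply: sw => u uX uw.
  have uA : u \in A by rewrite mem_filter uw eqxx.
  have ui := uA; rewrite -index_mem in ui.
  by have := Md (Ordinal ui); rewrite rowK /= nth_index.
have BA i : row i (rowsub (fullrankfun fM) M) \in A.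
  by rewrite row_rowsub rowK mem_nth.
exists (rowsub (fullrankfun fM) M); split=> [|i|i]; first exact: fullrowsub_free.
  by have := BA i; rewrite mem_filter => /andP[].
by have := BA i; rewrite mem_filter => /andP[/eqP].
Qed.

Variables (M : vec -> coefs) (S : vec -> vertex_choice).
Arguments M _ _ _ : clear implicits.
Hypothesis M0 : forall u i j, 0 <= M u i j.
Hypothesis MS : forall u i, M u i (S u i) = 0.
Hypothesis ME : forall u, u = comb (M u).

(* The support function of the product of simplices circumscribed about [Hpoly X h]. *)
Definition hS u : R := \sum_i \sum_j M u i j * h (y i j).

Lemma hS_vertex u (s : vertex_choice) v :
  (forall i, M u i (s i) = 0) ->
  (forall i j, j != s i -> dot (y i j) v = h (y i j)) -> dot u v = hS u.
Proof.
move=> Ms Hv; rewrite {1}(ME u) dot_comb; apply: eq_bigr => i _.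
apply: eq_bigr => j _; have [->|/Hv->//] := eqVneq j (s i).
by rewrite Ms !mul0r.
Qed.

Lemma hS_ge u x : (forall i j, dot (y i j) x <= h (y i j)) -> dot u x <= hS u.
Proof.
move=> Hx; rewrite {1}(ME u) dot_comb; apply: ler_sum => i _; apply: ler_sum => j _.
by rewrite ler_wpM2l.
Qed.

Lemma hS_skeleton i (j : idx i) : hS (y i j) <= h (y i j).
Proof.
have [[p Hp] _] := Xh; have [v Hv] := skeleton_vertex h (S (y i j)).
rewrite -(hS_vertex (MS _) Hv); apply: skeleton_vertex_le Hv _ _ => i' j'.
by apply/ltW/Hp/yX.
Qed.

Lemma unit_dot_lt1 u v : dot u u = 1 -> dot v v = 1 -> v != u -> dot v u < 1.
Proof.
move=> uu vv vu; have : 0 < dot (v - u) (v - u).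
  rewrite lt_neqAle dot_ge0 andbT eq_sym; apply: contra_neq vu => /dot_eq0/eqP.
  by rewrite subr_eq0 => /eqP.
by rewrite dotBl !dotBr uu vv (dotC u v); lra.
Qed.

(** Adding [e] moves all hyperplanes outwards by the same distance. From the vertex maximising [u],
    a step [e *: u] reaches the hyperplane of [u] and no other, as distinct unit vectors have inner
    product below [1]. *)
Lemma hS_irredundant (e : R) : 0 < e -> irredundant X (fun u => hS u + e).
Proof.
move=> e0; have [[p Hp] _] := Xh.
have yp i (j : idx i) : dot (y i j) p <= h (y i j) by apply/ltW/Hp/yX.
split; first by exists p => u uX; rewrite ltr_pwDr ?hS_ge.
move=> u uX; have [v Hv] := skeleton_vertex h (S u).
exists (v + e *: u); split.
  by rewrite dotDr dotZr X1 // mulr1 (hS_vertex (MS u) Hv).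
move=> u' u'X u'u; rewrite dotDr dotZr; apply: ler_ltD.
  by apply: hS_ge; exact: skeleton_vertex_le yp Hv.
by rewrite gtr_pMr // unit_dot_lt1 // X1.
Qed.

Lemma term_le_sum (F : coefs) i0 j0 :
  (forall i j, 0 <= F i j) -> F i0 j0 <= \sum_i \sum_j F i j.
Proof.
move=> F0; rewrite (bigD1 i0) //= (bigD1 j0) //= -addrA lerDl addr_ge0 //.
  by apply: sumr_ge0 => j _.
by apply: sumr_ge0 => i _; apply: sumr_ge0 => j _.
Qed.

(* Compare with the polytope [hS + e], whose vertices are close to those of the product
   of simplices, and move the vertex over by [vertex_transfer]. *)
Lemma vertex_cone w :
  Hpoly X h w -> active_spanning X h w ->
  exists s : vertex_choice, forall u, u \in X -> dot u w = h u ->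
    forall i, M u i (s i) = 0.
Proof.
move=> Pw sw; have [B [fB BX Bw]] := vertex_basis Pw sw.
have [[p Hp] _] := Xh.
(* The weighted total slack in factor [i] for the offsets [h], the same at every point and positive
   by comparison with [p]. *)
pose H i := \sum_j l j * h (y i j).
have H0 i (j : idx i) : 0 < H i.
  have -> : H i = \sum_j l j * (h (y i j) - dot (y i j) p).
    under [RHS]eq_bigr do rewrite mulrBr -dotZl.
    by rewrite sumrB -dot_suml ly dot0l subr0.
  rewrite (bigD1 j) //= ltr_pwDl //; first by rewrite mulr_gt0 // subr_gt0 Hp.
  by apply: sumr_ge0 => j' _; rewrite mulr_ge0 ?subr_ge0 // ltW // Hp.
have [e [e0 He]] : exists e, 0 < e /\ forall u, u \in X -> forall i (j : idx i),
    0 < M u i j -> e * (\sum_i \sum_j M u i j) < M u i j * H i.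
  apply/small_wit/small_all => u _; apply: small_forall => i.
  apply: small_forall => j; have [Mu|Mu] := ltP 0 (M u i j).
    apply: smallW (small_lt (\sum_i \sum_j M u i j) (mulr_gt0 Mu (H0 i j))).
    by move=> t _ + _.
  exact: small_true.
have Xe := hS_irredundant e0.
have [z Bz] := row_free_solve (fun i => hS (row i B) + e) fB.
have Pz := vertex_transfer uniqX X1 equivX Xh Xe fB BX Bw Bz Pw.
pose sl i (j : idx i) := h (y i j) + e - dot (y i j) z.
have sl0 i (j : idx i) : 0 <= sl i j.
  by rewrite subr_ge0; apply: le_trans (Pz _ (yX j)) _; rewrite lerD2r hS_skeleton.
(* The slacks [sl i] have weighted mean [H i + e], so one of them is at least [H i]; the normal with
   this large slack is the one to leave out. *)
have big i : exists j : idx i, H i <= sl i j.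
  apply: contrapT => no.
  have : \sum_(j : idx i) l j * sl i j <= \sum_(j : idx i) l j * H i.
    apply: ler_sum => j _; rewrite ler_pM2l // leNgt; apply/negP => /ltW Hj.
    by apply: no; exists j.
  rewrite -mulr_suml l1 mul1r.
  under eq_bigr do rewrite mulrBr mulrDr -dotZl.
  rewrite sumrB -dot_suml ly dot0l subr0 big_split /= -mulr_suml l1 mul1r.
  by rewrite gerDl leNgt e0.
pose s i := projT1 (cid (big i)).
have Hs i : H i <= sl i (s i) by exact: (projT2 (cid (big i))).
exists [fprod i => s i] => u uX uw i; rewrite fprodE.
have [i0 uB] := concurrent_basis uniqX X1 equivX Xh fB BX Bw uX uw.
have uz : dot u z = hS u + e by rewrite uB Bz.
(* Since [u] is tight at [z], the slacks weighted by [M u] have a sum of order [e]; by the choice of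
   [e], a positive coefficient on a slack of size [H i] would exceed it. *)
have slE : \sum_i \sum_j M u i j * sl i j = e * (\sum_i \sum_j M u i j) - e.
  have -> : \sum_i \sum_j M u i j * sl i j =
      hS u + e * (\sum_i \sum_j M u i j) - dot u z.
    have -> : dot u z = \sum_i \sum_j M u i j * dot (y i j) z.
      by rewrite {1}(ME u) dot_comb.
    rewrite mulr_sumr -big_split -sumrB /=; apply: eq_bigr => i' _.
    rewrite mulr_sumr -big_split -sumrB /=; apply: eq_bigr => j _.
    by rewrite /sl; ring.
  by rewrite uz; ring.
apply/eqP; rewrite eq_le M0 andbT leNgt; apply/negP => Mu.
have := He u uX i (s i) Mu; rewrite ltNge => /negP; apply.
apply: (@le_trans _ _ (M u i (s i) * sl i (s i))); first by rewrite ler_pM2l.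
apply: le_trans (@term_le_sum (fun i j => M u i j * sl i j) i (s i) _) _.
  by move=> i' j'; rewrite mulr_ge0.
by rewrite slE gerBl ltW.
Qed.

(** With [w] a vertex of largest weight in [x], the translate is [(1 - eps) P + eps v], where [v] is
    the vertex of the product of simplices assigned to [w]. Normals active at [w] satisfy
    [h u <= dot u v], and the others have slack at [x] bounded below in terms of their slack at
    [w]. *)
Lemma skeleton_cover :
  small (fun eps : R => exists ts : seq vec,
    (size ts <= \prod_(i < k) size (Xs i))%N /\
    forall x, Hpoly X h x -> exists2 t, t \in ts &
      exists y, Hpoly X h y /\ x = (1 - eps) *: y + t).
Proof.
have [W [HW convW]] := Hpoly_conv h skeleton_pos_spanning.
have [V HV] := choice (skeleton_vertex h).
have [T HT] : exists T : vec -> vertex_choice, forall w, w \in W ->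
    forall u, u \in X -> dot u w = h u -> forall i, M u i (T w i) = 0.
  suff H : forall w, exists s : vertex_choice, w \in W ->
      forall u, u \in X -> dot u w = h u -> forall i, M u i (s i) = 0.
    by have [T] := choice H; exists T.
  move=> w; have [wW|wW] := boolP (w \in W); last by exists (S 0).
  by have [Pw sw] := (HW w).1 wW; have [s Hs] := vertex_cone Pw sw; exists s.
have hSh u : u \in X -> h u <= hS u.
  move=> uX; have [q [Pq <-]] := irredundant_max Xh uX.
  by apply: hS_ge => i j; exact: Pq.
have N0 w : w \in W -> 0 < (size W)%:R :> R by case: (W).
have : small (fun eps : R => eps < 1 /\ forall w, w \in W -> forall u, u \in X ->
    dot u w != h u -> eps * (h u - dot u (V (T w))) < (size W)%:R^-1 * (h u - dot u w)).
  apply: small_and; first by exists 1; split=> // t /andP[].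
  apply: small_all => w wW; apply: small_all => u uX.
  have [_|uw] := eqVneq (dot u w) (h u); first exact: small_true.
  have a0 : 0 < (size W)%:R^-1 * (h u - dot u w).
    rewrite mulr_gt0 ?invr_gt0 ?(N0 w) // subr_gt0 lt_neqAle uw.
    by have [Pw _] := (HW w).1 wW; exact: Pw.
  by apply: smallW (small_lt (h u - dot u (V (T w))) a0) => t _ + _.
apply: smallW => eps eps0 [eps1 Heps].
exists [seq eps *: V s | s <- enum vertex_choice]; split.
  rewrite size_map -cardE card_fprod; apply/eq_leq/eq_bigr => i _.
  exact: card_ord.
move=> x Px; have [c [c0 [c1 xE]]] := convW x Px.
have [i0 _] : exists i : 'I_(size W), True.
  apply: contrapT => no; have := c1; rewrite big1 => [/esym/eqP|i].
    by rewrite oner_eq0.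
  by case: no; exists i.
have [i _ imax] := seq_argmin (fun i => - c i) (mem_enum 'I_(size W) i0).
pose w := W`_i; have wW : w \in W by rewrite mem_nth.
(* The largest of [size W] weights with sum [1] is at least their mean. *)
have ci : (size W)%:R^-1 <= c i.
  rewrite -[leLHS]mul1r ler_pdivrMr ?(N0 w) // mulr_natr -c1.
  rewrite -[X in _ *+ X](card_ord (size W)) -sumr_const; apply: ler_sum => j _.
  by have := imax j; rewrite mem_enum lerN2; apply.
have slack u : u \in X -> c i * (h u - dot u w) <= h u - dot u x.
  move=> uX; have -> : h u - dot u x = \sum_j c j * (h u - dot u W`_j).
    under eq_bigr do rewrite mulrBr -dotZr.
    by rewrite sumrB -mulr_suml c1 mul1r -dot_sumr -xE.
  rewrite (bigD1 i) //= lerDl; apply: sumr_ge0 => j _.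
  rewrite mulr_ge0 // subr_ge0; have [Pw _] := (HW W`_j).1 (mem_nth _ (ltn_ord j)).
  exact: Pw.
exists (eps *: V (T w)).
  by apply: map_f; rewrite mem_enum.
have e1 : 0 < 1 - eps by rewrite subr_gt0.
exists ((1 - eps)^-1 *: (x - eps *: V (T w))); split; last first.
  by rewrite scalerA divff ?gt_eqF // scale1r subrK.
move=> u uX; rewrite dotZr dotBr dotZr mulrC ler_pdivrMr //.
(* Membership in the translate, rewritten as a comparison of slacks at [V (T w)] and at [x]. *)
suff : eps * (h u - dot u (V (T w))) <= h u - dot u x by lra.
have [uw|uw] := eqVneq (dot u w) (h u).
  apply: (@le_trans _ _ 0); last by rewrite subr_ge0 Px.
  rewrite pmulr_rle0 // subr_le0 (hS_vertex (HT w wW u uX uw) (HV (T w))).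
  exact: hSh.
apply: le_trans (slack u uX); apply: ltW.
apply: lt_le_trans (Heps w wW u uX uw) _; rewrite ler_wpM2r // subr_ge0.
by have [Pw _] := (HW w).1 wW; exact: Pw.
Qed.

End Skeleton.

Theorem theorem1p4 (R : realType) (n k : nat) (P : 'rV[R]_n -> Prop)
    (Xs : 'I_k -> seq 'rV[R]_n) :
  strongly_monotypic P ->
  skeleton (facet_normal P) Xs ->
  (exists eps0 : R, 0 < eps0 /\
     forall eps : R, 0 < eps < eps0 ->
       exists ts : seq 'rV[R]_n,
         (size ts <= \prod_(i < k) size (Xs i))%N /\
         forall x, P x ->
           exists2 t, t \in ts & exists y, P y /\ x = (1 - eps) *: y + t)
  /\ (\prod_(i < k) size (Xs i) <= 2 ^ n)%N.
Proof.
move=> [polyP [fullP monoP]] [_ [_ [XsP [_ [Xssimp dsXs]]]]].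
have [X [h [uniqX X1 Xh PX]]] := polytope_facets polyP fullP.
have PE : P = Hpoly X h by apply: funext => x; apply/propext/PX.
subst P; clear PX.
have facE u := irredundant_facets u X1 Xh.
have yX i (j : 'I_(size (Xs i))) : (Xs i)`_j \in X.
  by apply/facE/(XsP i)/mem_nth.
pose l i := projT1 (cid (Xssimp i).2).
have Hl i : (forall j, 0 < l i j) /\ \sum_j l i j = 1 /\ \sum_j l i j *: (Xs i)`_j = 0.
  exact: (projT2 (cid (Xssimp i).2)).
have l0 i j : 0 < l i j by have [] := Hl i.
have l1 i : \sum_j l i j = 1 by have [_ []] := Hl i.
have ly i : \sum_j l i j *: (Xs i)`_j = 0 by have [_ []] := Hl i.
have affXs i := (Xssimp i).1.
have [M HM] := choice (skeleton_cone l0 l1 ly dsXs).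
have [S HS] := choice HM.
have M0 u i j : 0 <= M u i j by have [] := HS u.
have MS u i : M u i (S u i) = 0 by have [] := HS u.
have ME u : u = comb (M u) by have [] := HS u.
(* The choice [S 0] shows that no [Xs i] is empty and serves as the vertex required by
   [skeleton_card]. *)
split; last exact: (skeleton_card l0 l1 ly affXs dsXs (S 0)).
apply: (skeleton_cover l0 l1 ly affXs dsXs uniqX X1 Xh _ yX M0 MS ME).
move=> g Xg; apply: monoP.
- apply: Hpoly_is_polytope; first exact: (skeleton_pos_spanning l0 l1 ly dsXs yX).
  by have [[c Hc] _] := Xg; exists c; exact: strictly_inside_Hpoly.
- by have [[c Hc] _] := Xg; exact: strictly_inside_full_dim Hc.
by move=> u; rewrite facE; exact: irredundant_facets.
Qed.
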